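(* Let $\lambda>0$ and consider the pure birth process (binary tree growth process) with rate $\lambda$. Let $Z(t)$ be the number of leaves of the tree at time $t$ and $G(t)$ the sum of the depths of the leaves present at time $t$. Then $$\lim_{t\to\infty}\operatorname{Var}\left(\frac{G(t)}{Z(t)}\right)=7.$$
   Context: Pure birth process with rate $\lambda>0$: a random binary tree growing in continuous time. At time $0$ the tree consists of a single root, which is the first (and only) leaf. Each leaf, after an exponentially distributed time with mean $1/\lambda$ from its creation, independently of everything else, extends the tree by creating two new leaves as its children; it then stops being a leaf, so it is replaced by two new leaves. The depth of a leaf is the number of edges on the path from the root to it; thus a leaf of depth $d$ is replaced by two leaves of depth $d+1$. $Z(t)$ denotes the number of leaves at time $t$ and $G(t)$ the sum of the depths of the leaves at time $t$, with $Z(0)=1$ and $G(0)=0$. *)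

(* Defs.v *)
From mathcomp Require Export all_boot all_order all_algebra finmap.
From mathcomp Require Export all_classical all_reals all_analysis.
Export numFieldNormedType.Exports.
Import Order.TTheory GRing.Theory Num.Theory.

Set Implicit Arguments.
Unset Strict Implicit.
Unset Printing Implicit Defensive.

Local Open Scope classical_set_scope.
Local Open Scope ring_scope.

Definition mutually_independent d (T : measurableType d) (R : realType)
    (P : probability T R) (I : eqType) (X : I -> {RV P >-> R}) : Prop :=
  forall (s : seq I) (B : I -> set R), uniq s -> (forall i, measurable (B i)) ->
    P (\big[setI/setT]_(i <- s) (X i @^-1` B i)) =
    (\prod_(i <- s) P (X i @^-1` B i))%E.

Definition has_exponential_law d (T : measurableType d) (R : realType)
    (P : probability T R) (lambda : R) (X : {RV P >-> R}) : Prop :=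
  forall A : set R, measurable A ->
    distribution P X A = exponential_prob lambda A.

(* The nodes of the infinite binary tree are the words over bool: the root is
   [::], and the children of v are false :: v and true :: v, the most recent
   branching choice coming first, so that the depth of v is size v. *)
Notation node := (seq bool).

(* tau v is the time elapsed between the creation of the node v and the
   creation of its two children. *)
Definition pure_birth_lifetimes d (T : measurableType d) (R : realType)
    (P : probability T R) (lambda : R) (tau : node -> {RV P >-> R}) : Prop :=
  (forall v, has_exponential_law lambda (tau v)) /\ mutually_independent tau.

(* tau : node -> R is one realization of the lifetimes. *)
Fixpoint creation_time (R : realType) (tau : node -> R) (v : node) : R :=
  if v is _ :: u then creation_time tau u + tau u else 0.

Definition leaves (R : realType) (tau : node -> R) (t : R) : set node :=
  [set v | creation_time tau v <= t < creation_time tau v + tau v].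

(* The set of leaves is almost surely finite; on the exceptional null event
   where it is not, fset_set returns the empty set and the two numbers below
   are 0. *)
Definition leaf_count (R : realType) (tau : node -> R) (t : R) : nat :=
  #|` fset_set (leaves tau t)|.

Definition leaf_depth_sum (R : realType) (tau : node -> R) (t : R) : nat :=
  (\sum_(v <- fset_set (leaves tau t)) size v)%N.

(* Main.v *)
(* Conditionally on having [n] leaves, the tree is distributed like a random
   binary search tree: the event that it has a given shape [A] at time [t] has
   probability [e^(-lambda t) (1 - e^(-lambda t))^(n - 1) w(A)], where [w] is
   multiplicative along the two root subtrees up to the factor [1 / (n - 1)].
   This follows by induction on [A], conditioning on the lifetime of the root.
   These probabilities sum to [1], so explosion needs no separate argument, and
   [Z] is geometric with parameter [p = e^(-lambda t)].

   Hence the moments of [G / Z] are averages over a geometric [n] of the moments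
   of the external path length, which are known in closed form from the quicksort
   recurrence: mean [2 n (H_n - 1)] and variance [(7 - 4 H_n^(2)) n^2 + O(n H_n)].
   With [q = 1 - p] and [L = \sum_k q^k / (k + 1)], Abel summation gives
   [E H_Z = L] and [E (H_Z^2 - H_Z^(2)) = q L^2], so that the two contributions
   of the harmonic numbers cancel up to [4 p L^2], and the variance is [7] minus
   terms bounded by a multiple of [p (1 + L)^2].  Since [L <= 1 + lambda t],
   these terms vanish at infinity. *)
From HB Require Import structures.
Require Import Defs.
From mathcomp Require Import all_boot all_order all_algebra finmap.
From mathcomp Require Import all_classical all_reals all_analysis.
From mathcomp Require Import measurable_realfun ring lra zify.
Import Order.TTheory GRing.Theory Num.Theory.
Import numFieldNormedType.Exports.

Set Implicit Arguments.
Unset Strict Implicit.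
Unset Printing Implicit Defensive.

Local Open Scope classical_set_scope.
Local Open Scope ring_scope.

(** * Closed forms for the quicksort recurrences *)

Section convolution.
Context {R : comPzRingType}.
Implicit Types a b : nat -> R.

(** Both sums include the index [n], so on generating functions [partial_sum] multiplies by
    [1 / (1 - x)] and [conv] is the product. *)
Definition partial_sum a (n : nat) : R := \sum_(i < n.+1) a i.
Definition conv a b (n : nat) : R := \sum_(i < n.+1) a i * b (n - i)%N.

Lemma partial_sum0 a : partial_sum a 0 = a 0%N.
Proof. by rewrite /partial_sum big_ord1. Qed.

Lemma partial_sumS a n : partial_sum a n.+1 = partial_sum a n + a n.+1.
Proof. by rewrite /partial_sum big_ord_recr. Qed.

Lemma partial_sumSl a n :
  partial_sum a n.+1 = a 0%N + partial_sum (fun i => a i.+1) n.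
Proof. by rewrite /partial_sum big_ord_recl. Qed.

Lemma eq_partial_sum a b : a =1 b -> partial_sum a =1 partial_sum b.
Proof. by move=> ab n; apply: eq_bigr => i _; rewrite ab. Qed.

Lemma conv0 a b : conv a b 0 = a 0%N * b 0%N.
Proof. by rewrite /conv big_ord1. Qed.

Lemma convSl a b n :
  conv a b n.+1 = a 0%N * b n.+1 + conv (fun i => a i.+1) b n.
Proof. by rewrite /conv big_ord_recl subn0. Qed.

Lemma convC a b n : conv a b n = conv b a n.
Proof.
rewrite /conv (reindex_inj rev_ord_inj) /=; apply: eq_bigr => i _.
by rewrite mulrC subSS subKn // -ltnS.
Qed.

Lemma eq_conv a a' b b' : a =1 a' -> b =1 b' -> conv a b =1 conv a' b'.
Proof. by move=> aa' bb' n; apply: eq_bigr => i _; rewrite aa' bb'. Qed.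

Lemma convDl a a' b n : conv (fun i => a i + a' i) b n = conv a b n + conv a' b n.
Proof. by rewrite /conv -big_split; apply: eq_bigr => i _; rewrite mulrDl. Qed.

Lemma convZl c a b n : conv (fun i => c * a i) b n = c * conv a b n.
Proof. by rewrite /conv mulr_sumr; apply: eq_bigr => i _; rewrite mulrA. Qed.

(** A factor [1 / (1 - x)] can be pulled out of a product of generating functions. *)
Lemma conv_partial_suml a b n :
  conv (partial_sum a) b n = partial_sum (conv a b) n.
Proof.
elim: n a => [|n IHn] a; first by rewrite conv0 !partial_sum0 conv0.
rewrite convSl (eq_conv (partial_sumSl a) (frefl b)) convDl IHn.
rewrite (partial_sumSl (conv a b)) conv0 (eq_partial_sum (convSl a b)).
rewrite /partial_sum big_split -mulr_sumr /= big_ord1 !addrA; congr (_ + _).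
rewrite convC /conv -mulr_suml (mulrC _ (a 0%N)) -!mulrDr; congr (_ * _).
transitivity (\sum_(i < n.+2) b i); last by rewrite big_ord_recl.
by rewrite [RHS]big_ord_recr /= addrC.
Qed.

Lemma conv_partial_sumr a b n :
  conv a (partial_sum b) n = partial_sum (conv a b) n.
Proof.
rewrite convC conv_partial_suml; apply: eq_partial_sum => k; exact: convC.
Qed.

End convolution.

(** * Harmonic sums and the moments of the external path length *)

Section harmonic.
Context {R : realType}.

Local Ltac nat_neq0 n := repeat (apply/andP; split); apply: lt0r_neq0;
  have := ler0n R n; lra.

Definition harm (n : nat) : R := \sum_(i < n) i.+1%:R^-1.
Definition harm2 (n : nat) : R := \sum_(i < n) i.+1%:R^-2.

Lemma harmS n : harm n.+1 = harm n + n.+1%:R^-1.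
Proof. by rewrite /harm big_ord_recr. Qed.

Lemma harm2S n : harm2 n.+1 = harm2 n + n.+1%:R^-2.
Proof. by rewrite /harm2 big_ord_recr. Qed.

Lemma harm0 : harm 0 = 0. Proof. exact: big_ord0. Qed.
Lemma harm20 : harm2 0 = 0. Proof. exact: big_ord0. Qed.

Lemma harm_ge0 n : 0 <= harm n.
Proof. by apply: sumr_ge0 => i _; rewrite invr_ge0. Qed.

Lemma harm_le_nat n : harm n <= n%:R.
Proof.
elim: n => [|n IHn]; first by rewrite harm0.
by rewrite harmS -[leRHS]natr1 lerD // invf_le1 ?ltr0n // ler1n.
Qed.

(** Twice the sum of [1 / (i j)] over [1 <= i < j <= n], that is, the coefficient of [x^n] in
    [log(1 - x)^2 / (1 - x)]. *)
Definition harmonic_sum2 (n : nat) : R := harm n ^+ 2 - harm2 n.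

Lemma harmonic_sum2S n :
  harmonic_sum2 n.+1 = harmonic_sum2 n + 2 * harm n / n.+1%:R.
Proof.
rewrite /harmonic_sum2 harmS harm2S; field; nat_neq0 n.
Qed.

Definition inv_succ (n : nat) : R := n.+1%:R^-1.

(** Partial fractions: [1 / (x (y - x)) = (1 / x + 1 / (y - x)) / y] with [x = i + 1] and
    [y = n + 2]; the two resulting sums agree after reversing the index. *)
Lemma conv_inv_succ n :
  conv inv_succ inv_succ n = 2 * harm n.+1 / n.+2%:R.
Proof.
have E (i : 'I_n.+1) : inv_succ i * inv_succ (n - i)%N =
    n.+2%:R^-1 * (inv_succ i + inv_succ (n - i)%N).
  have ni : (n - i)%N.+1%:R = n.+2%:R - i.+1%:R :> R.
    by rewrite -natrB ?ltnS 1?ltnW // subSS subSn // -ltnS.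
  have i0 : i.+1%:R != 0 :> R by rewrite pnatr_eq0.
  have n0 : n.+2%:R != 0 :> R by rewrite pnatr_eq0.
  have ni0 : (n - i)%N.+1%:R != 0 :> R by rewrite pnatr_eq0.
  rewrite /inv_succ; move: ni0; rewrite ni => ni0.
  move: i0 n0 ni0; move: n.+2%:R i.+1%:R => x y y0 x0 xy0.
  by field; rewrite y0 x0 xy0.
rewrite /conv (eq_bigr _ (fun i _ => E i)) -mulr_sumr big_split /=.
rewrite [X in _ + X](reindex_inj rev_ord_inj) /=.
rewrite [X in _ + X](eq_bigr (fun i : 'I_n.+1 => inv_succ i)); last first.
  by move=> i _; rewrite subSS subKn // -ltnS.
by rewrite -[\sum_(i < _) _]/(harm n.+1); ring.
Qed.

Let nat2 n : n.+2%:R = n%:R + 2 :> R. Proof. by rewrite -addn2 natrD. Qed.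
Let nat3 n : n.+3%:R = n%:R + 3 :> R. Proof. by rewrite -addn3 natrD. Qed.
Let nat4 n : n.+4%:R = n%:R + 4 :> R. Proof. by rewrite -addn4 natrD. Qed.

(** Coefficients of [log(1 - x)^2 / (x^2 (1 - x))]; the closed forms below multiply this series by
    further factors [1 / (1 - x)]. *)
Let e_ n := harmonic_sum2 n.+2.

Lemma partial_sum1_conv n : partial_sum (conv inv_succ inv_succ) n = e_ n.
Proof.
elim: n => [|n IHn].
  rewrite partial_sum0 conv_inv_succ /e_ !harmonic_sum2S harm0.
  by rewrite /harmonic_sum2 harm0 harm20 harmS harm0; field.
by rewrite partial_sumS IHn conv_inv_succ /e_ (harmonic_sum2S n.+2).
Qed.

Lemma partial_sum2_conv n : partial_sum e_ n =
  (n%:R + 3) * e_ n - 2 * (n%:R + 2) * harm n.+2 + 2 * (n%:R + 2).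
Proof.
elim: n => [|n IHn].
  rewrite partial_sum0 /e_ !harmonic_sum2S.
  by rewrite /harmonic_sum2 !harmS harm0 harm20; field.
rewrite partial_sumS IHn /e_ !(harmonic_sum2S n.+2) (harmS n.+2) nat3 -natr1.
by field; nat_neq0 n.
Qed.

Lemma partial_sum3_conv n : partial_sum (partial_sum e_) n =
  let N : R := n%:R + 2 in
  e_ n * (1 + 3 / 2 * N + N ^+ 2 / 2)
  - harm n.+2 * (5 / 2 * N + 3 / 2 * N ^+ 2) + 9 / 4 * N + 7 / 4 * N ^+ 2.
Proof.
elim: n => [|n IHn].
  rewrite !partial_sum0 /e_ !harmonic_sum2S.
  by rewrite /harmonic_sum2 !harmS harm0 harm20; field.
rewrite partial_sumS IHn partial_sum2_conv /e_ !(harmonic_sum2S n.+2).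
rewrite (harmS n.+2) nat3 -natr1 /=.
by field; nat_neq0 n.
Qed.

(* First and second moments of the external path length of a random binary
   search tree with [n] internal nodes; here [N] is its number of leaves. *)
Definition mean_path (n : nat) : R := 2 * n.+1%:R * (harm n.+1 - 1).

Definition sq_mean_path (n : nat) : R :=
  let N : R := n.+1%:R in
  N ^+ 2 * (7 - N^-1 - 2 * N^-2 - 2 * harm n / N
            + 4 * harmonic_sum2 n.+1 - 8 * harm n.+1 + 4).

Lemma mean_path0 : mean_path 0 = 0.
Proof. by rewrite /mean_path harmS harm0; field. Qed.

(** The generating function of [mean_path] is [-2 log(1 - x) / (1 - x)^2]. *)
Lemma mean_pathS n :
  mean_path n.+1 = 2 * partial_sum (partial_sum inv_succ) n.
Proof.
have Ph k : partial_sum inv_succ k = harm k.+1 by [].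
elim: n => [|n IHn].
  by rewrite !partial_sum0 /mean_path !harmS harm0 /inv_succ; field.
rewrite partial_sumS mulrDr -IHn Ph /mean_path !(harmS n.+2) nat2 nat3.
by field; nat_neq0 n.
Qed.

(** The quicksort recurrence: the left root subtree has uniform size in [0..n], and each of the
    [n + 2] leaves lies one level deeper than in its subtree. *)
Lemma sum_mean_path n :
  mean_path n.+1 = n.+2%:R + 2 / n.+1%:R * partial_sum mean_path n.
Proof.
suff -> : partial_sum mean_path n =
    n.+1%:R / 2 * (mean_path n.+1 - n.+2%:R).
  by field; nat_neq0 n.
elim: n => [|n IHn].
  by rewrite partial_sum0 /mean_path !harmS harm0; field.
rewrite partial_sumS IHn /mean_path !(harmS n.+2) (harmS n.+1).
rewrite nat2 nat3 -natr1.
by field; nat_neq0 n.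
Qed.

(** Both factors vanish at 0 and may be shifted. Four partial sums then come out of the convolution,
    and the innermost one turns [conv inv_succ inv_succ] into [e_]. *)
Lemma conv_mean_pathSS n : conv mean_path mean_path n.+2 =
  4 * partial_sum (partial_sum (partial_sum e_)) n.
Proof.
rewrite convSl mean_path0 mul0r add0r convC convSl mean_path0 mul0r add0r.
rewrite (eq_conv mean_pathS mean_pathS) convZl convC convZl.
rewrite conv_partial_suml mulrA -natrM; congr (_ * _).
have E4 : conv (partial_sum inv_succ) (partial_sum (partial_sum inv_succ)) =1
    partial_sum (partial_sum e_).
  move=> k; rewrite conv_partial_suml; apply: eq_partial_sum => {}k.
  rewrite conv_partial_sumr; apply: eq_partial_sum => {}k.
  by rewrite conv_partial_sumr; exact: partial_sum1_conv.
exact: eq_partial_sum.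
Qed.

Lemma sq_mean_path0 : sq_mean_path 0 = 0.
Proof.
rewrite /sq_mean_path /= harmonic_sum2S harmS /harmonic_sum2 harm0 harm20.
by field.
Qed.

(** The recurrence for the second moment, from expanding the square of the two subtree path lengths
    plus [n + 2]; the convolution is the cross term of the independent subtrees. *)
Lemma sum_sq_mean_path n : sq_mean_path n.+1 = n.+2%:R ^+ 2 +
  n.+1%:R^-1 * (2 * partial_sum sq_mean_path n
    + 2 * conv mean_path mean_path n
    + 4 * n.+2%:R * partial_sum mean_path n).
Proof.
suff E : n.+1%:R * (sq_mean_path n.+1 - n.+2%:R ^+ 2) =
    2 * partial_sum sq_mean_path n + 2 * conv mean_path mean_path n
    + 4 * n.+2%:R * partial_sum mean_path n.
  by rewrite -E mulKf ?pnatr_eq0 // subrKC.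
case: n => [|n].
  rewrite !partial_sum0 conv0 sq_mean_path0 mean_path0 /sq_mean_path.
  by rewrite !harmonic_sum2S !harmS /harmonic_sum2 harm0 harm20; field.
have Pm k : partial_sum mean_path k =
    k.+1%:R / 2 * (mean_path k.+1 - k.+2%:R).
  by rewrite sum_mean_path; field; nat_neq0 k.
rewrite Pm; elim: n => [|n IHn].
  rewrite partial_sumS convSl conv0 partial_sum0 mean_path0.
  rewrite sq_mean_path0 /sq_mean_path /mean_path.
  by rewrite !harmonic_sum2S !harmS /harmonic_sum2 harm0 harm20; field.
rewrite partial_sumS.
(* The induction hypothesis absorbs the sum of second moments, leaving only the increment of the
   convolution to evaluate. *)
have -> : 2 * (partial_sum sq_mean_path n.+1 + sq_mean_path n.+2) +
    2 * conv mean_path mean_path n.+2 +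
    4 * n.+4%:R * (n.+3%:R / 2 * (mean_path n.+3 - n.+4%:R)) =
  n.+2%:R * (sq_mean_path n.+2 - n.+3%:R ^+ 2) + 2 * sq_mean_path n.+2
  + 2 * (conv mean_path mean_path n.+2 - conv mean_path mean_path n.+1)
  + 4 * n.+4%:R * (n.+3%:R / 2 * (mean_path n.+3 - n.+4%:R))
  - 4 * n.+3%:R * (n.+2%:R / 2 * (mean_path n.+2 - n.+3%:R)).
  rewrite IHn; ring.
have -> : conv mean_path mean_path n.+2 - conv mean_path mean_path n.+1 =
    4 * partial_sum (partial_sum e_) n.
  (* [conv_mean_pathSS] starts at index 2, so for [n = 0] the lower convolution, which is zero, is
     computed directly. *)
  case: n {IHn} => [|n].
    by rewrite conv_mean_pathSS convSl conv0 partial_sum0 mean_path0; ring.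
  by rewrite !conv_mean_pathSS (partial_sumS _ n); ring.
rewrite partial_sum3_conv /= /sq_mean_path /mean_path /e_.
rewrite (harmonic_sum2S n.+3) (harmonic_sum2S n.+2) (harmS n.+3) (harmS n.+2).
rewrite nat2 nat3 nat4.
by field; nat_neq0 n.
Qed.

End harmonic.

(** * Geometric averages and the logarithmic series *)

Section series_tools.
Context {R : realType}.
Implicit Types u a : R^nat.

Lemma series_partial_sum u n : series u n.+1 = partial_sum u n.
Proof. by rewrite seriesEord. Qed.

Lemma cvg_partial_sum u (l : R) :
  (partial_sum u @ \oo --> l) = (series u @ \oo --> l).
Proof.
have -> : partial_sum u = [sequence series u n.+1]_n.
  by apply/funext => n /=; rewrite series_partial_sum.
exact: cvg_shiftS.
Qed.

Lemma cvg_seriesD u a (l m : R) :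
  series u @ \oo --> l -> series a @ \oo --> m ->
  series (fun n => u n + a n) @ \oo --> l + m.
Proof. by move=> ul am; rewrite -[X in series X]/(u + a) seriesD; exact: cvgD. Qed.

Lemma cvg_seriesZ c u (l : R) :
  series u @ \oo --> l -> series (fun n => c * u n) @ \oo --> c * l.
Proof.
move=> ul; rewrite -[X in series X]/(c *: u) seriesZ.
exact: cvgZr.
Qed.

Lemma cvg_series_lag u (l : R) : u 0%N = 0 ->
  series (fun n => u n.+1) @ \oo --> l -> series u @ \oo --> l.
Proof.
move=> u0 ul; rewrite -(cvg_shiftS (series u)).
suff -> : [sequence series u n.+1]_n = series (fun n => u n.+1) by [].
by apply/funext => n; rewrite !seriesEord /= big_ord_recl u0 add0r.
Qed.

(** Cauchy product by squeezing: for nonnegative terms, the partial sums [C] of the product and [S]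
    of the factor satisfy [C n <= S n ^+ 2 <= C n.*2]. *)
Lemma cvg_conv_square a (l : R) : (forall n, 0 <= a n) ->
  series a @ \oo --> l -> series (conv a a) @ \oo --> l ^+ 2.
Proof.
move=> a0; rewrite -!cvg_partial_sum => al.
pose S := partial_sum a; pose C := partial_sum (conv a a).
have ndS : nondecreasing_seq S.
  by apply/nondecreasing_seqP => n; rewrite /S partial_sumS lerDl.
have S0 n : 0 <= S n by apply: sumr_ge0.
have ndC : nondecreasing_seq C.
  apply/nondecreasing_seqP => n; rewrite /C partial_sumS lerDl.
  by apply: sumr_ge0 => i _; rewrite mulr_ge0.
have CE n : C n = \sum_(i < n.+1) a i * S (n - i)%N.
  by rewrite /C -conv_partial_sumr.
have C_le n : C n <= S n ^+ 2.
  rewrite CE expr2 {2}/S /partial_sum mulr_suml; apply: ler_sum => i _.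
  by rewrite ler_wpM2l // ndS // leq_subr.
have le_C n : S n ^+ 2 <= C n.*2.
  rewrite CE expr2 {1}/S /partial_sum mulr_suml.
  have nn : (n.+1 <= n.*2.+1)%N by rewrite ltnS -addnn leq_addr.
  rewrite (big_ord_widen _ (fun i => a i * S n) nn) big_mkcond /=.
  apply: ler_sum => i _; case: ifPn => [|_]; last by rewrite mulr_ge0.
  by rewrite ltnS => ni; rewrite ler_wpM2l // ndS //; lia.
have S_le n : S n <= l.
  by rewrite -(cvg_lim _ al) //; apply: nondecreasing_cvgn_le => //; exact: cvgP al.
have cC : cvgn C.
  apply: nondecreasing_is_cvgn => //; exists (l ^+ 2) => _ [n _ <-].
  by rewrite (le_trans (C_le n)) // ler_pXn2r // nnegrE // (le_trans (S0 n)).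
have S2 : (fun n => S n ^+ 2) @ \oo --> l ^+ 2.
  by rewrite expr2; under eq_fun do rewrite expr2; exact: cvgM.
suff -> : l ^+ 2 = limn C by [].
apply: (cvg_unique _ S2) => //.
apply: (@squeeze_cvgr _ _ _ _ C (fun n => C n.*2)) => //.
  by near=> n; rewrite C_le le_C.
move=> A /cC[N _ NA]; exists N => // n /= Nn; apply: NA => /=.
by rewrite (leq_trans Nn) // -addnn leq_addr.
Unshelve. all: by end_near. Qed.

Variable q : R.
Hypotheses (q0 : 0 <= q) (q1 : q < 1).

Let q_norm : `|q| < 1. Proof. by rewrite ger0_norm. Qed.

(** With [r] the square root of [q], comparing [n r^n] with the sum of the first [n] powers of [r]
    gives [n r^n <= 1 / (1 - r)], so [n q^n <= r^n / (1 - r)]. *)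
Lemma cvg_natM_expr : (fun n => n%:R * q ^+ n) @ \oo --> (0 : R).
Proof.
pose r := Num.sqrt q.
have r0 : 0 <= r by rewrite sqrtr_ge0.
have r1 : r < 1 by rewrite -[ltRHS]sqrtr1 ltr_sqrt.
have r'0 : 0 < 1 - r by rewrite subr_gt0.
have rN : `|r| < 1 by rewrite ger0_norm.
have nr n : n%:R * r ^+ n <= (1 - r)^-1.
  rewrite -[leRHS]mul1r ler_pdivlMr //.
  apply: (@le_trans _ _ ((\sum_(i < n) r ^+ i) * (1 - r))).
    rewrite ler_wpM2r ?(ltW r'0) // -[n in n%:R]card_ord -sum1_card natr_sum mulr_suml.
    apply: ler_sum => i _; rewrite mul1r; apply: ler_wiXn2l => //.
    - exact: ltW.
    - exact: ltnW.
  by rewrite mulrC -opprB mulNr -subrX1 opprB lerBlDr lerDl exprn_ge0.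
apply: (@squeeze_cvgr _ _ _ _ (fun=> 0) (geometric (1 - r)^-1 r)).
- near=> n; rewrite mulr_ge0 ?exprn_ge0 //= -(sqr_sqrtr q0) -/r.
  by rewrite -exprM mul2n -addnn exprD mulrA ler_wpM2r ?exprn_ge0.
- exact: cvg_cst.
- exact: cvg_geometric.
Unshelve. all: by end_near. Qed.

(** Here [n] stands for the number of internal nodes, one less than the number of leaves, so the
    geometric law starts at 0. Summability and value are stated together. *)
Definition geometric_mean u (l : R) :=
  series (fun n => (1 - q) * q ^+ n * u n) @ \oo --> l.

Lemma geometric_meanD u a l m : geometric_mean u l -> geometric_mean a m ->
  geometric_mean (fun n => u n + a n) (l + m).
Proof.
move=> ul am; rewrite /geometric_mean; under eq_fun do rewrite mulrDr.
exact: cvg_seriesD.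
Qed.

Lemma geometric_meanZ c u l : geometric_mean u l ->
  geometric_mean (fun n => c * u n) (c * l).
Proof.
move=> ul; rewrite /geometric_mean; under eq_fun do rewrite mulrCA.
exact: cvg_seriesZ.
Qed.

Lemma eq_geometric_mean u a l : u =1 a -> geometric_mean u l ->
  geometric_mean a l.
Proof. by move=> /funext ->. Qed.

Lemma geometric_mean_series u l : series (fun n => q ^+ n * u n) @ \oo --> l ->
  geometric_mean u ((1 - q) * l).
Proof.
move=> ul; rewrite /geometric_mean; under eq_fun do rewrite -mulrA.
exact: cvg_seriesZ.
Qed.

(** Abel summation. The boundary term [q^N] times the sum of the first [N] terms is at most
    [C N q^N], which tends to 0. *)
Lemma geometric_mean_partial_sum a (C l : R) : (forall n, `|a n| <= C) ->
  series (fun n => q ^+ n * a n) @ \oo --> l ->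
  geometric_mean (partial_sum a) l.
Proof.
move=> aC al; rewrite /geometric_mean.
have E N : series (fun n => (1 - q) * q ^+ n * partial_sum a n) N =
    series (fun n => q ^+ n * a n) N - q ^+ N * series a N.
  elim: N => [|N IHN].
    by rewrite !seriesEord /= !big_ord0 mulr0 subr0.
  by rewrite !(seriesSr _ N) IHN -series_partial_sum seriesSr exprS; ring.
rewrite (funext E).
rewrite -[l]subr0; apply: cvgB => //.
apply/norm_cvg0P; apply: (@squeeze_cvgr _ _ _ _ (fun=> 0) (fun n => C * (n%:R * q ^+ n))).
- near=> n; rewrite normr_ge0 /= normrM ger0_norm ?exprn_ge0 // mulrA mulrC.
  rewrite ler_wpM2r ?exprn_ge0 // seriesEord /=.
  rewrite (le_trans (ler_norm_sum _ _ _)) //.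
  rewrite mulr_natr -[n in leRHS]card_ord -sumr_const.
  by apply: ler_sum => i _; exact: aC.
- exact: cvg_cst.
- by rewrite -[X in _ --> X](mulr0 C); apply: cvgZr; exact: cvg_natM_expr.
Unshelve. all: by end_near. Qed.

Lemma geometric_mean_cst c : geometric_mean (fun=> c) c.
Proof.
have := @cvg_geometric_series R c q q_norm.
move/(@cvg_seriesZ (1 - q)); rewrite mulrCA mulfV ?mulr1; last first.
  by rewrite subr_eq0 gt_eqF.
by apply: cvg_trans; under eq_fun do rewrite mulrAC -mulrA.
Qed.

Lemma geometric_mean_le u a l m : (forall n, u n <= a n) ->
  geometric_mean u l -> geometric_mean a m -> l <= m.
Proof.
move=> ua ul am; apply: (ler_cvg_to ul am).
near=> n; rewrite !seriesEord /=; apply: ler_sum => i _.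
by rewrite ler_wpM2l // mulr_ge0 ?exprn_ge0 // subr_ge0 ltW.
Unshelve. all: by end_near. Qed.

End series_tools.

Arguments cvg_seriesZ {R} c {u l}.
Arguments geometric_meanZ {R q} c {u l}.
Arguments geometric_mean_cst {R q} q0 q1 c.

(** * The logarithmic series and the exact variance for a geometric size *)

Section log_series.
Context {R : realType}.
Variable q : R.
Hypotheses (q0 : 0 <= q) (q1 : q < 1).

Let p0 : 0 < 1 - q. Proof. by rewrite subr_gt0. Qed.
Let qN : `|q| < 1. Proof. by rewrite ger0_norm. Qed.

(** For [q > 0] this is [- ln(1 - q) / q], and [dilog_series] is the dilogarithm of [q] divided by
    [q]. *)
Definition log_series : R := limn (series (fun n => q ^+ n * inv_succ n)).
Definition dilog_series : R :=
  limn (series (fun n => q ^+ n * (inv_succ n * inv_succ n))).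

Lemma inv_succ_ge0 n : 0 <= inv_succ n :> R.
Proof. by rewrite invr_ge0. Qed.

Lemma inv_succ_le1 n : inv_succ n <= 1 :> R.
Proof. by rewrite invf_le1 ?ltr0n // ler1n. Qed.

Lemma cvg_expr_series (u : R^nat) : (forall n, 0 <= u n <= 1) ->
  cvgn (series (fun n => q ^+ n * u n)).
Proof.
move=> u01; apply: (@series_le_cvg _ _ (geometric 1 q)) => [n|n|n|].
- by rewrite mulr_ge0 ?exprn_ge0 //; have /andP[] := u01 n.
- exact: geometric_ge0.
- by rewrite /= mul1r ler_piMr ?exprn_ge0 //; have /andP[] := u01 n.
- exact: is_cvg_geometric_series.
Qed.

Lemma cvg_log_series : series (fun n => q ^+ n * inv_succ n) @ \oo --> log_series.
Proof. by apply: cvg_expr_series => n; rewrite inv_succ_ge0 inv_succ_le1. Qed.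

Lemma cvg_dilog_series :
  series (fun n => q ^+ n * (inv_succ n * inv_succ n)) @ \oo --> dilog_series.
Proof.
apply: cvg_expr_series => n.
by rewrite mulr_ge0 ?inv_succ_ge0 // mulr_ile1 ?inv_succ_ge0 ?inv_succ_le1.
Qed.

Lemma log_series_ge0 : 0 <= log_series.
Proof.
apply: (cvgr_to_ge cvg_log_series); near=> n; rewrite seriesEord /=.
by apply: sumr_ge0 => i _; rewrite mulr_ge0 ?exprn_ge0 ?inv_succ_ge0.
Unshelve. all: by end_near. Qed.

Lemma dilog_series_ge0 : 0 <= dilog_series.
Proof.
apply: (cvgr_to_ge cvg_dilog_series); near=> n; rewrite seriesEord /=.
by apply: sumr_ge0 => i _; rewrite !mulr_ge0 ?exprn_ge0 ?inv_succ_ge0.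
Unshelve. all: by end_near. Qed.

Lemma dilog_series_le : dilog_series <= log_series.
Proof.
apply: (ler_cvg_to cvg_dilog_series cvg_log_series); near=> n.
rewrite !seriesEord /=; apply: ler_sum => i _.
by rewrite ler_wpM2l ?exprn_ge0 // ler_piMr ?inv_succ_ge0 ?inv_succ_le1.
Unshelve. all: by end_near. Qed.

Lemma geometric_mean_harm : geometric_mean q (fun n => harm n.+1) log_series.
Proof.
apply: (@geometric_mean_partial_sum _ _ q0 q1 inv_succ 1).
  by move=> n; rewrite ger0_norm ?inv_succ_ge0 ?inv_succ_le1.
exact: cvg_log_series.
Qed.

Let a_ (n : nat) : R := 2 * harm n / n.+1%:R.

(** By [conv_inv_succ], the shifted coefficients are those of the square of the logarithmic
    series. *)
Lemma cvg_harm_series :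
  series (fun n => q ^+ n * a_ n) @ \oo --> q * log_series ^+ 2.
Proof.
have /cvg_conv_square : forall n, 0 <= q ^+ n * inv_succ n.
  by move=> n; rewrite mulr_ge0 ?exprn_ge0 ?inv_succ_ge0.
move=> /(_ _ cvg_log_series) /(cvg_seriesZ q).
set u := (X in series X) => ul; apply: cvg_series_lag.
  by rewrite /a_ harm0 mulr0 mul0r mulr0.
suff -> : (fun n => q ^+ n.+1 * a_ n.+1) = u by [].
apply/funext => n; rewrite /u exprS -mulrA; congr (_ * _).
rewrite /a_ -conv_inv_succ /conv mulr_sumr; apply: eq_bigr => i _.
rewrite mulrACA -exprD subnKC //; exact: leq_ord.
Qed.

Lemma geometric_mean_harmonic_sum2 :
  geometric_mean q (fun n => harmonic_sum2 n.+1) (q * log_series ^+ 2).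
Proof.
have E : partial_sum a_ =1 (fun n => harmonic_sum2 n.+1).
  elim=> [|n IHn]; last by rewrite partial_sumS IHn -harmonic_sum2S.
  by rewrite partial_sum0 harmonic_sum2S /harmonic_sum2 /a_ harm0 harm20; ring.
apply: (eq_geometric_mean E); apply: (@geometric_mean_partial_sum _ _ q0 q1 _ 2).
  move=> n; rewrite ger0_norm ?divr_ge0 ?mulr_ge0 ?harm_ge0 //.
  rewrite ler_pdivrMr ?ltr0n // ler_pM2l // (le_trans (harm_le_nat n)) //.
  by rewrite ler_nat.
exact: cvg_harm_series.
Qed.

Lemma geometric_mean_mean_path :
  geometric_mean q (fun n => mean_path n / n.+1%:R) (2 * (log_series - 1)).
Proof.
apply: (@eq_geometric_mean _ _ (fun n => 2 * (harm n.+1 + -1))).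
  by move=> n; rewrite /mean_path; field; rewrite nat1r pnatr_eq0.
apply/geometric_meanZ/geometric_meanD; first exact: geometric_mean_harm.
exact: geometric_mean_cst.
Qed.

(** The exact variance of the ratio at the time where [expR (- (lambda * t)) = 1 - q]; the value 7
    appears only as [q] tends to 1. *)
Definition limit_variance : R :=
  7 - (1 - q) * (log_series + 2 * dilog_series + (q + 4) * log_series ^+ 2).

(** The averaged polynomial is the conditional expectation of [(G / Z - c)^2] given the size.
    [sq_mean_path] is written in terms whose averages are known: [2 * harm n / N] is an increment of
    [harmonic_sum2], and 11 is [7 + 4]. The terms [4 q L^2] and [- 4 L^2] leave only
    [- 4 (1 - q) L^2]. *)
Lemma geometric_mean_variance (c := 2 * (log_series - 1)) :
  geometric_mean q (fun n => sq_mean_path n / n.+1%:R ^+ 2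
    + (- (2 * c)) * (mean_path n / n.+1%:R) + c ^+ 2) limit_variance.
Proof.
have M1 := geometric_mean_series cvg_log_series.
have M2 := geometric_mean_series cvg_dilog_series.
have M3 := geometric_mean_series cvg_harm_series.
have M4 := geometric_mean_harmonic_sum2.
have M5 := geometric_mean_harm.
have M6 := @geometric_mean_cst _ _ q0 q1.
have := geometric_meanD (geometric_meanD
  (geometric_meanD (geometric_meanD (geometric_meanD
  (geometric_meanD (M6 11) (geometric_meanZ (-1) M1)) (geometric_meanZ (-2) M2))
  (geometric_meanZ (-1) M3)) (geometric_meanZ 4 M4)) (geometric_meanZ (-8) M5))
  (geometric_meanD (geometric_meanZ (- (2 * c)) geometric_mean_mean_path)
     (M6 (c ^+ 2))).
set l := (X in geometric_mean _ _ X) => Hl.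
have -> : limit_variance = l by rewrite /limit_variance /l /c; ring.
apply: eq_geometric_mean Hl => n; rewrite addrA; congr (_ + _ + _).
by rewrite /sq_mean_path /a_ /inv_succ; field; rewrite nat1r pnatr_eq0.
Qed.

(** The increment satisfies [1 / (n + 2) <= - ln(1 - 1 / (n + 2))], by [ln(1 + x) <= x]. *)
Lemma harm_le_ln n : harm n.+1 <= 1 + ln n.+1%:R :> R.
Proof.
elim: n => [|n IHn]; first by rewrite harmS harm0 invr1 ln1 addr0 add0r.
rewrite harmS (le_trans (lerD IHn (lexx _))) // -addrA lerD2l.
rewrite -lerBrDl -ln_div ?posrE ?ltr0n //.
have -> : n.+2%:R / n.+1%:R = (1 + - n.+2%:R^-1)^-1 :> R.
  have n2 : n.+2%:R != 0 :> R by rewrite pnatr_eq0.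
  have n1 : n.+1%:R != 0 :> R by rewrite pnatr_eq0.
  have -> : 1 + - n.+2%:R^-1 = n.+1%:R / n.+2%:R :> R.
    by rewrite -[n.+2]addn1 natrD; move: n2; rewrite -[n.+2]addn1 natrD => n2; field.
  by rewrite invf_div.
have i0 : (0 : R) < n.+2%:R^-1 by rewrite invr_gt0.
have i1 : n.+2%:R^-1 < 1 :> R by rewrite invf_lt1 // ltr1n.
rewrite lnV ?posrE ?subr_gt0 // lerNr; apply: le_ln1Dx.
by rewrite ltrN2.
Qed.

(** Jensen's inequality for [ln], by its tangent line: with [p = 1 - q], [ln(p N) <= p N - 1], and
    [N] has geometric mean [1 / p]. It is applied to [harm N <= 1 + ln N]. *)
Lemma log_series_le_ln : log_series <= 1 - ln (1 - q).
Proof.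
have p0' : 1 - q != 0 by rewrite gt_eqF.
have M1 : geometric_mean q (fun n => n.+1%:R) (1 - q)^-1.
  have : geometric_mean q (partial_sum (fun=> 1)) (1 - q)^-1.
    apply: (@geometric_mean_partial_sum _ _ q0 q1 _ 1) => [n|].
      by rewrite normr1.
    have -> : (fun n => q ^+ n * 1) = geometric 1 q.
      by apply/funext => n; rewrite /= mulrC.
    by rewrite -[X in _ --> X]mul1r; exact: cvg_geometric_series.
  apply: eq_geometric_mean => n.
  by rewrite /partial_sum sumr_const card_ord.
have := geometric_meanD (geometric_mean_cst q0 q1 (- ln (1 - q)))
  (geometric_meanZ (1 - q) M1).
rewrite mulfV // => M2; rewrite [leRHS]addrC.
apply: (geometric_mean_le q0 q1 _ geometric_mean_harm M2) => n.
rewrite (le_trans (harm_le_ln n)) //.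
have : ln ((1 - q) * n.+1%:R) <= (1 - q) * n.+1%:R - 1.
  rewrite -[X in ln X](subrKC 1); apply: le_ln1Dx.
  by rewrite -subr_gt0 opprK subrK mulr_gt0 ?ltr0n.
rewrite lnM ?posrE ?ltr0n //; lra.
Qed.

End log_series.

(** * Convergence of the exact variance to 7 *)

Section limit_variance_cvg.
Context {R : realType}.

(** With [x = lambda t], the bracket is at most [3 L + 5 L^2 <= 8 (1 + x)^2]. The constant 2048 is
    [8 * 256], where [(1 + x)^4 <= 256 expR x] is the fourth power of
    [(1 + x) / 4 <= expR (x / 4)]. *)
Lemma limit_variance_bound (x : R) : 0 <= x ->
  `|limit_variance (1 - expR (- x)) - 7| <= 2048 / (1 + x).
Proof.
move=> x0; set q := 1 - expR (- x).
have q0 : 0 <= q by rewrite subr_ge0 -[leRHS]expR0 ler_expR oppr_le0.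
have q1 : q < 1 by rewrite ltrBlDr ltrDl expR_gt0.
have pE : 1 - q = expR (- x) by rewrite /q; ring.
have L0 := log_series_ge0 q0 q1; have D0 := dilog_series_ge0 q0 q1.
have DL := dilog_series_le q0 q1; have := log_series_le_ln q0 q1.
rewrite /limit_variance; rewrite pE expRK opprK.
move: (log_series q) (dilog_series q) L0 D0 DL => L D L0 D0 DL Lx.
have e4 : expR (- x) * (1 + x) ^+ 4 <= 256.
  rewrite expRN ler_pdivrMl ?expR_gt0 //.
  have -> : expR x = expR (x / 4) ^+ 4.
    by rewrite -expRM_natl; congr expR; field.
  have -> : (1 + x) ^+ 4 = 4 ^+ 4 * ((1 + x) / 4) ^+ 4 by field.
  have -> : 256 = 4 ^+ 4 :> R by ring.
  rewrite mulrC ler_pM2r ?exprn_gt0 //; apply: lerXn2r; rewrite ?nnegrE ?expR_ge0 //.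
    by rewrite divr_ge0 ?addr_ge0.
  by apply: le_trans (expR_ge1Dx _); lra.
have x1 : 0 < 1 + x by lra.
have e0 := expR_gt0 (- x).
rewrite [X in `|X|](_ : _ =
  - (expR (- x) * (L + 2 * D + (q + 4) * L ^+ 2))); last by ring.
rewrite normrN ger0_norm; last by apply: mulr_ge0; [exact: ltW|nra].
rewrite ler_pdivlMr //.
have le8 : L + 2 * D + (q + 4) * L ^+ 2 <= 8 * (1 + x) ^+ 2.
  nra.
have : expR (- x) * (L + 2 * D + (q + 4) * L ^+ 2) * (1 + x) <=
    8 * (expR (- x) * (1 + x) ^+ 4).
  rewrite [leRHS]mulrCA -mulrA ler_pM2l //.
  apply: (@le_trans _ _ (8 * (1 + x) ^+ 2 * (1 + x))).
    by rewrite ler_pM2r.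
  rewrite -mulrA ler_pM2l // -exprSr; apply: ler_weXn2l => //; lra.
by lra.
Qed.

Lemma cvg_limit_variance (lambda : R) : 0 < lambda ->
  limit_variance (1 - expR (- (lambda * t))) @[t --> +oo] --> (7 : R).
Proof.
move=> l0; apply/cvgrPdist_le => e e0; near=> t.
have t0 : 0 <= lambda * t by rewrite mulr_ge0 // ltW.
rewrite distrC (le_trans (limit_variance_bound t0)) //.
rewrite ler_pdivrMr ?ltr_pwDl // -ler_pdivrMl //.
rewrite (@le_trans _ _ (lambda * t)) // ?lerDr // -ler_pdivrMl //.
Unshelve. all: by end_near. Qed.

End limit_variance_cvg.

(** * Shapes of binary trees *)

Inductive shape := Leaf | Node of shape & shape.

HB.instance Definition _ := gen_eqMixin shape.
HB.instance Definition _ := gen_choiceMixin shape.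

Fixpoint internal (A : shape) : nat :=
  if A is Node a b then (internal a + internal b).+1 else 0%N.

Fixpoint path_length (A : shape) : nat :=
  if A is Node a b then
    (path_length a + path_length b + (internal a + internal b).+2)%N else 0%N.

(** Shapes of size [n + 1] need all smaller sizes, so the lists for [0..n] are kept in a table to
    make the recursion structural. *)
Fixpoint shape_table (n : nat) : seq (seq shape) :=
  if n is m.+1 then
    let t := shape_table m in
    rcons t (flatten [seq [seq Node a b | a <- nth [::] t i, b <- nth [::] t (m - i)]
                     | i <- iota 0 m.+1])
  else [:: [:: Leaf]].

Definition shapes (n : nat) : seq shape := nth [::] (shape_table n) n.

Lemma size_shape_table n : size (shape_table n) = n.+1.
Proof. by elim: n => //= n IHn; rewrite size_rcons IHn. Qed.

Lemma nth_shape_table n i : (i <= n)%N -> nth [::] (shape_table n) i = shapes i.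
Proof.
elim: n => [|n IHn]; first by case: i.
rewrite leq_eqVlt ltnS => /predU1P[-> //|ni] /=.
by rewrite nth_rcons size_shape_table ltnS ni IHn.
Qed.

Lemma shapesS n : shapes n.+1 =
  flatten [seq [seq Node a b | a <- shapes i, b <- shapes (n - i)] | i <- iota 0 n.+1].
Proof.
transitivity (flatten [seq [seq Node a b | a <- nth [::] (shape_table n) i,
    b <- nth [::] (shape_table n) (n - i)] | i <- iota 0 n.+1]).
  by rewrite [LHS]nth_rcons size_shape_table ltnn eqxx.
congr flatten; apply/eq_in_map => i; rewrite mem_iota ltnS /= => ni.
by rewrite !nth_shape_table // leq_subr.
Qed.

Lemma big_shapesS (V : Type) (idx : V) (op : Monoid.law idx) n (F : shape -> V) :
  \big[op/idx]_(A <- shapes n.+1) F A =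
  \big[op/idx]_(i < n.+1) \big[op/idx]_(a <- shapes i)
    \big[op/idx]_(b <- shapes (n - i)) F (Node a b).
Proof.
rewrite shapesS big_flatten big_map -[iota 0 n.+1]/(index_iota 0 n.+1) big_mkord.
by apply: eq_bigr => i _; rewrite big_allpairs_dep.
Qed.

(** Multiplicities give membership and absence of duplicates at once; for a node they factor over
    the two subtrees, and only one split of the size contributes. *)
Lemma count_shapes A n : count_mem A (shapes n) = (internal A == n).
Proof.
elim: A n => [|a IHa b IHb] [|n]; first by rewrite /= eqxx.
- rewrite -sum1_count big_mkcond big_shapesS big1 // => i _.
  rewrite big1 // => a _; rewrite big1 // => b _ /=.
  by case: eqP.
- by rewrite /=; case: eqP.
rewrite -sum1_count big_mkcond big_shapesS.
under eq_bigr => i _.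
  rewrite (_ : (\sum_(_ <- _) _)%N =
     (count_mem a (shapes i) * count_mem b (shapes (n - i)))%N).
    rewrite IHa IHb; over.
  have NE a' b' : (Node a' b' == Node a b) = (a' == a) && (b' == b).
    by apply/eqP/andP => [[-> ->]|[/eqP -> /eqP ->]].
  rewrite -!sum1_count big_distrl [RHS]big_mkcond; apply: eq_bigr => a' _ /=.
  rewrite mul1n -[eq_op a' a]/(a' == a); case: eqVneq => [->|na'].
    rewrite [RHS]big_mkcond; apply: eq_bigr => b' _ /=.
    by rewrite NE eqxx.
  by rewrite big1 // => b' _ /=; rewrite NE (negPf na').
rewrite /= eqSS; case: eqP => [<-|nab].
  have an : (internal a < (internal a + internal b).+1)%N.
    by rewrite ltnS leq_addr.
  rewrite (bigD1 (Ordinal an)) //= eqxx addKn eqxx big1 // => i ai.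
  by move: ai; rewrite -val_eqE /= eq_sym => /negPf ->.
rewrite big1 // => i _; case: eqP => // ai; case: eqP => // bi.
by case: nab; rewrite ai bi subnKC // -ltnS.
Qed.

Lemma mem_shapes A n : (A \in shapes n) = (internal A == n).
Proof. by rewrite -has_pred1 has_count count_shapes; case: eqP. Qed.

Lemma shapes_uniq n : uniq (shapes n).
Proof.
apply: count_mem_uniq => A.
by rewrite count_shapes mem_shapes.
Qed.

(** * The random binary search tree law on shapes and its path length moments *)

Section weights.
Context {R : realType}.

(** Unfolded, the product over internal nodes of the inverse of the number of internal nodes in the
    subtree rooted there. *)
Fixpoint weight (A : shape) : R :=
  if A is Node a b then weight a * weight b / (internal a + internal b).+1%:R
  else 1.

Lemma weight_ge0 A : 0 <= weight A.
Proof. by elim: A => //= a a0 b b0; rewrite divr_ge0 ?mulr_ge0. Qed.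

Definition shape_mean (F : shape -> R) (n : nat) : R :=
  \sum_(A <- shapes n) weight A * F A.

Lemma shape_mean0 F : shape_mean F 0 = F Leaf.
Proof. by rewrite /shape_mean big_seq1 mul1r. Qed.

(** Under [weight] the size of the left root subtree is uniform and, given the sizes, the two root
    subtrees are independent. *)
Lemma shape_meanS F n : shape_mean F n.+1 = n.+1%:R^-1 *
  \sum_(i < n.+1) shape_mean (fun a => shape_mean (fun b => F (Node a b)) (n - i)) i.
Proof.
rewrite /shape_mean big_shapesS mulr_sumr; apply: eq_bigr => i _.
rewrite mulr_sumr big_seq [RHS]big_seq; apply: eq_bigr => a.
rewrite mem_shapes => /eqP ai.
rewrite mulrCA mulrA mulr_sumr big_seq [RHS]big_seq; apply: eq_bigr => b.
rewrite mem_shapes => /eqP bi /=; rewrite ai bi subnKC; last exact: leq_ord.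
ring.
Qed.

Lemma shape_meanD F G n :
  shape_mean (fun A => F A + G A) n = shape_mean F n + shape_mean G n.
Proof. by rewrite /shape_mean -big_split; apply: eq_bigr => A _; rewrite mulrDr. Qed.

Lemma shape_meanZ c F n : shape_mean (fun A => c * F A) n = c * shape_mean F n.
Proof. by rewrite /shape_mean mulr_sumr; apply: eq_bigr => A _; rewrite mulrCA. Qed.

Lemma eq_shape_mean F G n : (forall A, internal A = n -> F A = G A) ->
  shape_mean F n = shape_mean G n.
Proof.
move=> FG; rewrite /shape_mean big_seq [RHS]big_seq; apply: eq_bigr => A.
by rewrite mem_shapes => /eqP /FG ->.
Qed.

Lemma shape_mean1 n : shape_mean (fun=> 1) n = 1.
Proof.
elim/ltn_ind: n => -[|n] IHn; first by rewrite shape_mean0.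
rewrite shape_meanS (eq_bigr (fun=> 1)); last first.
  move=> i _; rewrite -[RHS](IHn i) //; apply: eq_shape_mean => a _.
  by rewrite IHn // ltnS leq_subr.
by rewrite sumr_const card_ord mulVf // pnatr_eq0.
Qed.

Lemma shape_mean_cst c n : shape_mean (fun=> c) n = c.
Proof.
rewrite -[RHS]mulr1 -(shape_mean1 n) -shape_meanZ.
by apply: eq_shape_mean => A _; rewrite mulr1.
Qed.

Lemma shape_mean_path_length n :
  shape_mean (fun A => (path_length A)%:R) n = mean_path n.
Proof.
elim/ltn_ind: n => -[|n] IHn; first by rewrite shape_mean0 mean_path0.
rewrite shape_meanS sum_mean_path.
(* Naming [n.+2%:R] opaquely keeps it an atom for the algebraic tactics. *)
have [N NE] : {N : R | n.+2%:R = N} by exists n.+2%:R.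
rewrite NE.
rewrite (eq_bigr (fun i : 'I_n.+1 => mean_path i + mean_path (n - i)%N + N)).
  rewrite !big_split /= sumr_const card_ord.
  rewrite [X in _ + X + _](reindex_inj rev_ord_inj) /=.
  rewrite [X in _ + X + _](eq_bigr (fun i : 'I_n.+1 => mean_path i)); last first.
    by move=> i _; rewrite subSS subKn // -ltnS.
  rewrite -[\sum_(i < _) _]/(partial_sum mean_path n).
  by rewrite -(mulr_natr N); field; rewrite nat1r pnatr_eq0.
move=> i _; have ni : (n - i < n.+1)%N by rewrite ltnS leq_subr.
transitivity (shape_mean (fun a => (path_length a)%:R
   + (mean_path (n - i)%N + N)) i); last first.
  by rewrite shape_meanD shape_mean_cst IHn // addrA.
apply: eq_shape_mean => a ai.
transitivity (shape_mean (fun b => (path_length b)%:R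
   + ((path_length a)%:R + N)) (n - i)); last first.
  by rewrite shape_meanD shape_mean_cst IHn // addrCA.
apply: eq_shape_mean => b bi; rewrite /= ai bi subnKC; last exact: leq_ord.
by rewrite !natrD NE; ring.
Qed.

Lemma shape_mean_sq_path_length n :
  shape_mean (fun A => (path_length A)%:R ^+ 2) n = sq_mean_path n.
Proof.
elim/ltn_ind: n => -[|n] IHn.
  by rewrite shape_mean0 sq_mean_path0 expr0n.
rewrite shape_meanS sum_sq_mean_path.
have [N NE] : {N : R | n.+2%:R = N} by exists n.+2%:R.
rewrite NE.
rewrite (eq_bigr (fun i : 'I_n.+1 => sq_mean_path i + sq_mean_path (n - i)%N
   + 2 * (mean_path i * mean_path (n - i)%N)
   + 2 * N * (mean_path i + mean_path (n - i)%N) + N ^+ 2)).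
  rewrite !big_split /= -!mulr_sumr !big_split /= sumr_const card_ord.
  have rev (f : nat -> R) : \sum_(i < n.+1) f (n - i)%N = partial_sum f n.
    rewrite (reindex_inj rev_ord_inj) /=; apply: eq_bigr => i _.
    by rewrite subSS subKn // -ltnS.
  rewrite (rev sq_mean_path) (rev mean_path).
  rewrite -[\sum_(i < _) sq_mean_path i]/(partial_sum sq_mean_path n).
  rewrite -[\sum_(i < _) mean_path i]/(partial_sum mean_path n).
  rewrite -[\sum_(i < _) _]/(conv mean_path mean_path n).
  by rewrite -(mulr_natr N); field; rewrite ?nat1r pnatr_eq0.
move=> i _; have ni : (n - i < n.+1)%N by rewrite ltnS leq_subr.
set m := mean_path (n - i)%N.
transitivity (shape_mean (fun a => (path_length a)%:R ^+ 2
   + ((2 * m + 2 * N) * (path_length a)%:R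
   + (sq_mean_path (n - i)%N + 2 * N * m + N ^+ 2))) i); last first.
  rewrite !shape_meanD shape_meanZ !shape_mean_cst shape_mean_path_length IHn //.
  by rewrite /m; ring.
apply: eq_shape_mean => a ai; set x : R := (path_length a)%:R.
transitivity (shape_mean (fun b => (path_length b)%:R ^+ 2
   + (2 * (x + N) * (path_length b)%:R + (x + N) ^+ 2)) (n - i)); last first.
  rewrite !shape_meanD shape_meanZ !shape_mean_cst shape_mean_path_length IHn //.
  by rewrite /m; ring.
apply: eq_shape_mean => b bi; rewrite /= ai bi subnKC; last exact: leq_ord.
by rewrite !natrD NE -/x; ring.
Qed.

End weights.

(** * Independence and the law of the shape *)

Section independence.
Context d (T : measurableType d) (R : realType) (P : probability T R).

Local Open Scope ereal_scope.

Definition indep_events (A B : set T) : Prop := P (A `&` B) = P A * P B.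

Lemma indep_events_sym A B : indep_events A B -> indep_events B A.
Proof. by rewrite /indep_events setIC muleC. Qed.

Lemma sub_sigma_measurable (G : set (set T)) :
  G `<=` measurable -> <<s G >> `<=` measurable.
Proof. by move=> Gm; apply: smallest_sub => //; exact: sigma_algebra_measurable. Qed.

(** For fixed [C], the events independent of [C] are closed under complement and countable disjoint
    union, so the Dynkin class argument applies. *)
Lemma indep_events_dynkin (G : set (set T)) (C : set T) :
  setI_closed G -> G `<=` measurable -> measurable C ->
  (forall A, G A -> indep_events A C) ->
  forall A, <<s G >> A -> indep_events A C.
Proof.
move=> GI Gm mC GC; have sGm := sub_sigma_measurable Gm.
have indepC (S : set T) : measurable S -> indep_events S C ->
    indep_events (~` S) C.
  move=> mS SC; rewrite /indep_events setIC -setDE measureD //; last first.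
    by rewrite -ge0_fin_numE // fin_num_measure.
  rewrite [X in _ - X](_ : _ = P S * P C); last by rewrite setIC; exact: SC.
  rewrite probability_setC // muleBl ?mul1e ?fin_num_measure //.
have indepU (F : (set T)^nat) : (forall n, measurable (F n)) ->
    trivIset setT F -> (forall n, indep_events (F n) C) ->
    indep_events (\bigcup_k F k) C.
  move=> mF tF FC; rewrite /indep_events setI_bigcupl.
  rewrite measure_bigcup //; first last.
  - exact: trivIset_setIr.
  - by move=> i _; exact: measurableI.
  rewrite measure_bigcup // muleC -(@fineK _ (P C)) ?fin_num_measure //.
  rewrite -nneseriesZl //; apply: eq_eseriesr => i _.
  by rewrite fineK ?fin_num_measure // muleC; exact: FC.
apply: (@dynkin_induction _ (g_sigma_algebraType G) G
  (fun A : set T => indep_events A C)) => //.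
- by rewrite /indep_events setTI probability_setT mul1e.
- by move=> S mS; apply: indepC; exact: sGm.
- by move=> F mF; apply: indepU => n; apply: sGm; exact: mF.
Qed.

Section cylinders.
Context (I : choiceType) (X : I -> {RV P >-> R}).

(** A pi-system generating the sigma-algebra of the variables indexed by [J]. *)
Definition cylinders (J : pred I) : set (set T) :=
  [set A | exists s : seq I, exists B : I -> set R,
    [/\ uniq s, all J s, forall i, measurable (B i)
      & A = \big[setI/setT]_(i <- s) (X i @^-1` B i)]].

Lemma cylinders_measurable J : cylinders J `<=` measurable.
Proof.
move=> A [s [B [us Js mB ->]]]; apply: bigsetI_measurable => i _.
by rewrite -[_ @^-1` _]setTI; exact: measurable_funP.
Qed.

Lemma cylinders_setI_closed J : setI_closed (cylinders J).
Proof.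
move=> A1 A2 [s1 [B1 [u1 J1 m1 ->]]] [s2 [B2 [u2 J2 m2 ->]]].
(* The index lists are merged; each family of sets is extended by [setT] outside its own list. *)
exists (undup (s1 ++ s2)), (fun i => (if i \in s1 then B1 i else setT) `&`
  (if i \in s2 then B2 i else setT)); split.
- exact: undup_uniq.
- by rewrite all_undup all_cat J1.
- by move=> i; apply: measurableI; case: ifP.
- rewrite -!bigcap_seq; apply/seteqP; split => w /=.
    by move=> [w1 w2] i /=; case: ifP => [/w1|_]; case: ifP => [/w2|_].
  move=> wB; split=> i /= si; have /= := wB i.
    by rewrite mem_undup mem_cat si => /(_ isT)[].
  by rewrite mem_undup mem_cat si orbT => /(_ isT)[].
Qed.

Lemma cylinders_preimage (J : pred I) i (B : set R) : J i -> measurable B ->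
  cylinders J (X i @^-1` B).
Proof.
move=> Ji mB; exists [:: i], (fun=> B); split => //=; first by rewrite Ji.
by rewrite big_seq1.
Qed.

Hypothesis indX : mutually_independent X.

(** The Dynkin argument is used once on each side, which reduces the claim to two cylinders over
    disjoint finite lists. *)
Lemma cylinders_indep (J1 J2 : pred I) : (forall i, J1 i -> ~~ J2 i) ->
  forall A B, <<s cylinders J1 >> A -> <<s cylinders J2 >> B ->
  indep_events A B.
Proof.
move=> J12 A B sA sB.
have mB : measurable B by exact: (sub_sigma_measurable (@cylinders_measurable J2)).
apply: (indep_events_dynkin (@cylinders_setI_closed J1)
  (@cylinders_measurable J1) mB _ sA) => {sA}A cA; apply: indep_events_sym.
apply: (indep_events_dynkin (@cylinders_setI_closed J2)
  (@cylinders_measurable J2) (cylinders_measurable cA) _ sB) => {sB mB}B cB.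
apply: indep_events_sym.
move: cA cB => [s1 [B1 [u1 /allP j1 m1 ->]]] [s2 [B2 [u2 /allP j2 m2 ->]]].
have d12 i : i \in s2 -> (i \in s1) = false.
  by move=> si; apply: contraTF (j2 _ si) => /j1/J12.
have u12 : uniq (s1 ++ s2).
  by rewrite cat_uniq u1 u2 andbT /=; apply/hasPn => i /d12 /= ->.
(* As the lists are disjoint, both families of sets are restrictions of one family, to which joint
   independence applies. *)
pose Bi i := if i \in s1 then B1 i else B2 i.
have mBi i : measurable (Bi i) by rewrite /Bi; case: ifP.
have E1 (V : Type) (idx : V) (op : Monoid.law idx) (F : I -> set R -> V) :
    \big[op/idx]_(i <- s1) F i (B1 i) = \big[op/idx]_(i <- s1) F i (Bi i).
  by apply: eq_big_seq => i si; rewrite /Bi si.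
have E2 (V : Type) (idx : V) (op : Monoid.law idx) (F : I -> set R -> V) :
    \big[op/idx]_(i <- s2) F i (B2 i) = \big[op/idx]_(i <- s2) F i (Bi i).
  by apply: eq_big_seq => i si; rewrite /Bi d12.
rewrite (E1 _ _ _ (fun i B => X i @^-1` B)) (E2 _ _ _ (fun i B => X i @^-1` B)).
rewrite /indep_events -big_cat /= !indX // big_cat //.
Qed.

Lemma measurable_cylinders (J : pred I) i : J i ->
  measurable_fun setT (X i : g_sigma_algebraType (cylinders J) -> R).
Proof.
move=> Ji _ B mB; rewrite setTI; apply: sub_sigma_algebra.
exact: cylinders_preimage.
Qed.

End cylinders.

(** The map [w |-> (X w, w)], whose second component sees only the sigma-algebra of [G], has a
    product law, as checked on rectangles; the product measure is then computed by sections. *)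
Lemma probability_freeze (X : {RV P >-> R}) (G : set (set T))
    (E : set (R * g_sigma_algebraType G)) :
  G `<=` measurable ->
  (forall A B, measurable A -> <<s G >> B -> indep_events (X @^-1` A) B) ->
  measurable E ->
  P [set w | E (X w, w)] = \int[distribution P X]_s P (xsection E s).
Proof.
move=> Gm ind mE; have sGm := sub_sigma_measurable Gm.
pose T' : measurableType _ := g_sigma_algebraType G.
have mid : measurable_fun setT (id : T -> T').
  by move=> _ B mB; rewrite setTI; exact: sGm.
pose idm : {mfun T >-> T'} := HB.pack (id : T -> T')
  (isMeasurableFun.Build _ _ _ _ _ mid).
have mXid : measurable_fun setT (fun w : T => (X w, w : T')).
  by apply: measurable_fun_pair.
pose Xid : {mfun T >-> (R * T')%type} := HB.pack (fun w : T => (X w, w : T'))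
  (isMeasurableFun.Build _ _ _ _ _ mXid).
have := @product_measure_unique _ _ _ _ R (distribution P X) (distribution P idm)
  (distribution P Xid) _ E mE.
move=> H; symmetry; apply: H => A B mA mB; exact: ind.
Qed.

End independence.

(** * Integration against the exponential law *)

Section density.
Context {R : realType}.
Local Notation mu := (@lebesgue_measure R).
Local Open Scope ereal_scope.

(** Since [f] and the Radon-Nikodym derivative of [nu] have the same integrals over measurable
    subsets of [U], they agree almost everywhere there, and the change of variables formula passes
    to [f]. *)
Lemma integral_density (nu : probability (measurableTypeR R) R) (f : R -> R)
    (U : set R) (g : R -> \bar R) :
  (forall x, (0 <= f x)%R) -> measurable_fun setT f ->
  (forall A, measurable A -> nu A = \int[mu]_(x in A) (f x)%:E) ->
  measurable U -> measurable_fun U g -> (forall x, 0 <= g x) ->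
  \int[nu]_(x in U) g x = \int[mu]_(x in U) (g x * (f x)%:E).
Proof.
move=> f0 mf nuE mU mg g0.
have mfE : measurable_fun setT (EFin \o f) by exact/measurable_EFinP.
have nuac : nu `<< mu.
  apply/null_content_dominatesP => A mA A0; rewrite nuE //.
  by apply: null_set_integral => //; exact: measurable_funTS.
have intf : mu.-integrable setT (EFin \o f).
  apply/integrableP; split => //.
  under eq_integral do rewrite /= ger0_norm //.
  by rewrite -nuE // probability_setT ltry.
rewrite -(Radon_Nikodym_SigmaFinite.change_of_variables nuac) //.
pose h := Radon_Nikodym_SigmaFinite.f nu mu.
have inth : mu.-integrable setT h := Radon_Nikodym_SigmaFinite.f_integrable nuac.
apply: ae_eq_integral => //.
- apply: emeasurable_funM => //; apply: measurable_funTS.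
  exact: measurable_int inth.
- by apply: emeasurable_funM => //; exact: measurable_funTS.
apply: ae_eqe_mul2l; apply: integral_ae_eq => //.
- exact: integrableS inth.
- exact: measurable_funTS.
- by move=> A AU mA; rewrite -nuE // -Radon_Nikodym_SigmaFinite.f_integral.
Qed.

End density.

Section exponential.
Context d (T : measurableType d) (R : realType) (P : probability T R).
Context (lambda : R) (X : {RV P >-> R}).
Hypotheses (l0 : 0 < lambda) (expX : has_exponential_law lambda X).
Local Notation mu := (@lebesgue_measure R).

Lemma probability_exponential_gt (t : R) : 0 <= t ->
  P [set w | t < X w] = (expR (- (lambda * t)))%:E.
Proof.
move=> t0.
have -> : [set w | t < X w] = ~` (X @^-1` `]-oo, t]).
  by apply/seteqP; split => w /=; rewrite in_itv /= ltNge => /negP.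
have mX : measurable (X @^-1` `]-oo, t]).
  by rewrite -[_ @^-1` _]setTI; exact: measurable_funP.
rewrite probability_setC // -[P _]/(distribution P X _) expX //.
rewrite /exponential_prob.
have -> : (\int[mu]_(x in `]-oo, t]) (exponential_pdf lambda x)%:E =
           \int[mu]_(x in `[0%R, t]) (exponential_pdf lambda x)%:E)%E.
  rewrite integral_mkcond [RHS]integral_mkcond; apply: eq_integral => x _.
  rewrite !patchE; case: ifPn => [|xt].
    rewrite inE /= in_itv /= => xt; case: ifPn => //.
    rewrite notin_setE /= in_itv /= xt andbT => /negP; rewrite -ltNge => x0.
    by rewrite lt0_exponential_pdf.
  rewrite ifF //; apply/negbTE; apply: contra xt; rewrite !inE /= !in_itv /=.
  by case/andP.
(* [exponential_prob_itv0c] asks for a positive endpoint, so [t = 0] is settled apart. *)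
have [->|t1] := eqVneq t 0.
  by rewrite set_itv1 integral_set1 mulr0 oppr0 expR0 sube0.
rewrite -[X in (1 - X)%E]/(exponential_prob lambda `[0, t]).
rewrite exponential_prob_itv0c // ?lt_neqAle 1?eq_sym ?t1 //.
by rewrite -!EFinB mulNr; congr EFin; ring.
Qed.

Lemma integral_exponential_law (g : R -> \bar R) :
  measurable_fun setT g -> (forall x, 0 <= g x)%E ->
  (\int[distribution P X]_x g x =
   \int[mu]_x (g x * (exponential_pdf lambda x)%:E))%E.
Proof.
move=> mg g0; rewrite ge0_integral_distribution //.
have mX : measurable_fun setT (X : T -> measurableTypeR R).
  have mX : measurable_fun setT (X : T -> R) by exact: measurable_funP.
  exact mX.
pose X' : {mfun T >-> measurableTypeR R} :=
  HB.pack (X : T -> measurableTypeR R) (isMeasurableFun.Build _ _ _ _ _ mX).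
rewrite -[RHS](integral_density (nu := distribution P X')) //.
- by rewrite (ge0_integral_distribution X').
- by move=> x; exact: exponential_pdf_ge0 (ltW l0) _.
- exact: measurable_exponential_pdf.
Qed.

End exponential.

Section yule_integral.
Context {R : realType}.
Local Notation mu := (@lebesgue_measure R).

(** Put [u = expR (- (lambda * (t - x)))]. Then [expR (- (lambda * x))] is
    [expR (- (lambda * t)) / u], one factor [u] cancels, and the integrand is the derivative of a
    multiple of [(1 - u) ^+ m.+1]. Here [x] is the root lifetime, and the square comes from the two
    root subtrees. *)
Lemma integral_yule (lambda t c : R) (m : nat) : 0 <= t ->
  (\int[mu]_(x in `[0%R, t])
    (c * expR (- (lambda * (t - x))) ^+ 2 * (1 - expR (- (lambda * (t - x)))) ^+ m
     * (lambda * expR (- (lambda * x))))%:E =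
   (expR (- (lambda * t)) * (1 - expR (- (lambda * t))) ^+ m.+1 * (c / m.+1%:R))%:E)%E.
Proof.
move=> t0; have [->|t1] := eqVneq t 0.
  by rewrite set_itv1 integral_set1 mulr0 oppr0 expR0 subrr expr0n mulr0 mul0r.
have {t0 t1}t0 : 0 < t by rewrite lt_neqAle eq_sym t1.
pose k := - (expR (- (lambda * t)) * (c / m.+1%:R)).
pose F x := k * (1 - expR (lambda * x - lambda * t)) ^+ m.+1.
pose f x := - k * m.+1%:R * (1 - expR (lambda * x - lambda * t)) ^+ m
  * (lambda * expR (lambda * x - lambda * t)).
pose g x := lambda * x - lambda * t.
have dg (x : R) : is_derive x 1 g lambda.
  have /is_derive_eq : is_derive x 1 (lambda \*: id - cst (lambda * t))
    (lambda *: 1 - 0) by exact: is_deriveB.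
  by apply; rewrite subr0 [_ *: _]mulr1.
have du (x : R) : is_derive x 1 (expR \o g) (expR (g x) * lambda).
  exact: is_derive1_comp.
have dF (x : R) : is_derive x 1 F (f x).
  have -> : F = k \*: ((cst 1 - (expR \o g)) ^+ m.+1).
    by apply/funext => y; rewrite /F /= exprfctE.
  have /is_derive_eq : is_derive x 1 (k \*: ((cst 1 - (expR \o g)) ^+ m.+1))
      (k *: ((m.+1%:R * (cst 1 - (expR \o g)) x ^+ m) *: (0 - expR (g x) * lambda))).
    apply: is_deriveZ; apply: (@is_deriveX _ _ _ m.+1); exact: is_deriveB.
  apply; rewrite /f -/(g x) sub0r.
  transitivity (k * (m.+1%:R * (1 - expR (g x)) ^+ m * - (expR (g x) * lambda))).
    by [].
  ring.
have cu : continuous (expR \o g).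
  move=> x; apply/differentiable_continuous/derivable1_diffP.
  exact: ex_derive.
have cf : continuous f.
  have -> : f = (cst (- k * m.+1%:R) \* ((@GRing.exp R ^~ m) \o (cst 1 - (expR \o g))))
      \* (cst lambda \* (expR \o g)) by [].
  move=> x; apply: continuousM; last first.
    by apply: continuousM; [exact: cst_continuous|exact: cu].
  apply: continuousM; first exact: cst_continuous.
  apply: continuous_comp; last exact: exprn_continuous.
  by apply: continuousB; [exact: cst_continuous|exact: cu].
have E x : c * expR (- (lambda * (t - x))) ^+ 2 * (1 - expR (- (lambda * (t - x)))) ^+ m
     * (lambda * expR (- (lambda * x))) = f x.
  have -> : - (lambda * (t - x)) = lambda * x - lambda * t by ring.
  have -> : expR (- (lambda * x)) =
      expR (- (lambda * t)) / expR (lambda * x - lambda * t).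
    by rewrite -expRN -expRD; congr expR; ring.
  rewrite /f /k; field.
  by rewrite nat1r pnatr_eq0 expR_eq0.
under eq_integral do rewrite E.
rewrite (@continuous_FTC2 _ f F) //.
- have -> : F t = 0 by rewrite /F subrr expR0 subrr expr0n mulr0.
  by rewrite -EFinB /F /k mulr0 !sub0r; congr EFin; ring.
- by apply: continuous_subspaceT.
- split.
  + by move=> x _; exact: ex_derive.
  + apply/cvg_at_right_filter/differentiable_continuous/derivable1_diffP; exact: ex_derive.
  + apply/cvg_at_left_filter/differentiable_continuous/derivable1_diffP; exact: ex_derive.
- by move=> x _; rewrite derive1E; exact: derive_val.
Qed.

End yule_integral.

(** * The event that the tree has a given shape, and its measurability *)

Section grown.
Context {R : realType}.

(** The choice made at the root is the last letter of a word, hence [rcons]. *)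
Definition subtree (X : Type) (tau : node -> X) (b : bool) : node -> X :=
  fun v => tau (rcons v b).

(* The tree with lifetimes [tau] has shape [A] at time [r]. *)
Fixpoint grown (A : shape) (tau : node -> R) (r : R) : Prop :=
  match A with
  | Leaf => r < tau [::]
  | Node a b => [/\ 0 <= tau [::] <= r,
      grown a (subtree tau false) (r - tau [::]) &
      grown b (subtree tau true) (r - tau [::])]
  end.

Lemma grown_inj A B tau r : grown A tau r -> grown B tau r -> A = B.
Proof.
elim: A B tau r => [|a IHa b IHb] [|a' b'] //= tau r.
- by move=> rt [/andP[_ /le_lt_trans /(_ rt)]]; rewrite ltxx.
- by move=> [/andP[_ tr] _ _] rt; move: (le_lt_trans tr rt); rewrite ltxx.
- by move=> [_ ga gb] [_ /(IHa _ _ _ ga) -> /(IHb _ _ _ gb) ->].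
Qed.

Lemma measurable_set_ltr d (T : measurableType d) (f g : T -> R) :
  measurable_fun setT f -> measurable_fun setT g ->
  measurable [set x | f x < g x].
Proof.
move=> mf mg; rewrite -[X in measurable X]setTI.
exact: (measurable_fun_ltr mf mg measurableT (Y := [set true])).
Qed.

Lemma measurable_set_ler d (T : measurableType d) (f g : T -> R) :
  measurable_fun setT f -> measurable_fun setT g ->
  measurable [set x | f x <= g x].
Proof.
move=> mf mg; rewrite -[X in measurable X]setTI.
exact: (measurable_fun_ler mf mg measurableT (Y := [set true])).
Qed.

Lemma measurable_set_between d (T : measurableType d) (f g h : T -> R) :
  measurable_fun setT f -> measurable_fun setT g -> measurable_fun setT h ->
  measurable [set x | f x <= g x <= h x].
Proof.
move=> mf mg mh.
have -> : [set x | f x <= g x <= h x] =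
    [set x | f x <= g x] `&` [set x | g x <= h x].
  by apply/seteqP; split => x /= => [/andP[]|[-> ->]].
by apply: measurableI; exact: measurable_set_ler.
Qed.

(** Joint measurability in time and outcome is needed, because the recursion looks at the subtrees
    at the random time [r - tau [::]]. *)
Lemma measurable_grown d (T : measurableType d) A (X : node -> T -> R) :
  (forall v, measurable_fun setT (X v)) ->
  measurable [set rw : R * T | grown A (X^~ rw.2) rw.1].
Proof.
elim: A X => [|a IHa b IHb] X mX /=.
  apply: measurable_set_ltr; first exact: measurable_fst.
  exact: measurableT_comp.
pose h (rw : R * T) := (rw.1 - X [::] rw.2, rw.2).
have mX0 : measurable_fun setT (X [::] \o (snd : R * T -> T)).
  by apply: measurableT_comp.
have mh : measurable_fun setT h.
  apply: measurable_fun_pair; last exact: measurable_snd.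
  exact: measurable_funB.
have -> : [set rw : R * T | [/\ 0 <= X [::] rw.2 <= rw.1,
      grown a (subtree (X^~ rw.2) false) (rw.1 - X [::] rw.2) &
      grown b (subtree (X^~ rw.2) true) (rw.1 - X [::] rw.2)]] =
  [set rw : R * T | 0 <= X [::] rw.2 <= rw.1] `&`
  (h @^-1` [set rw | grown a (subtree X false ^~ rw.2) rw.1] `&`
   h @^-1` [set rw | grown b (subtree X true ^~ rw.2) rw.1]).
  by apply/seteqP; split => rw /= => [[? ? ?]|[? []]].
apply: measurableI.
  by apply: measurable_set_between => //; exact: measurable_fst.
apply: measurableI; rewrite -[_ @^-1` _]setTI; apply: mh => //.
  by apply: IHa => v; exact: mX.
by apply: IHb => v; exact: mX.
Qed.

Lemma measurable_grown_at d (T : measurableType d) A (X : node -> T -> R) r :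
  (forall v, measurable_fun setT (X v)) ->
  measurable [set w | grown A (X^~ w) r].
Proof.
move=> /(measurable_grown A) mA.
have mr : measurable_fun setT (fun w : T => (r, w)) by exact: measurable_fun_pair.
by have := mr measurableT _ mA; rewrite setTI.
Qed.

End grown.

(** * The probability of a given shape *)

Section prob_grown.
Context d (T : measurableType d) (R : realType) (P : probability T R).
Variable lambda : R.
Hypothesis l0 : 0 < lambda.
Implicit Type X : node -> {RV P >-> R}.

Lemma pure_birth_subtree X b : pure_birth_lifetimes lambda X ->
  pure_birth_lifetimes lambda (subtree X b).
Proof.
move=> [expX indX]; split => [v|s B us mB]; first exact: expX.
(* Removing the last letter extends [B] from the words [rcons v b] to all words. *)
pose B' (v : node) := B (take (size v).-1 v).
have B'E v : B' (rcons v b) = B v.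
  by rewrite /B' size_rcons -cats1 take_size_cat.
have := indX (map (rcons^~ b) s) B'; rewrite map_inj_uniq; last first.
  by move=> u v /eqP; rewrite eqseq_rcons => /andP[/eqP].
move=> /(_ us (fun v => mB _)); rewrite !big_map.
under eq_bigr do rewrite B'E.
by under [X in _ = X -> _]eq_bigr do rewrite B'E.
Qed.

(* The last letter of a word is the branching choice made at the root. *)
Definition below (b : bool) : pred node := fun v => last (~~ b) v == b.

(** Measurability of [grown] is instantiated on [T] with the smaller sigma-algebra, for which the
    lifetimes below the child [b] are still measurable. *)
Lemma sigma_below X A b r :
  <<s cylinders X (below b) >> [set w | grown A (fun v => subtree X b v w) r].
Proof.
have H := measurable_grown_at (T := g_sigma_algebraType (cylinders X (below b)))
  A (X := fun v w => subtree X b v w) r.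
refine (H _) => v.
by apply: measurable_cylinders; rewrite /below last_rcons.
Qed.

(** The root lifetime is frozen at [s]; both subtrees then have age [t - s], are independent, and
    fall under the induction hypothesis. [integral_yule] integrates [s] out. *)
Lemma prob_grown A X t : pure_birth_lifetimes lambda X -> 0 <= t ->
  P [set w | grown A (fun v => X v w) t] =
  (expR (- (lambda * t)) * (1 - expR (- (lambda * t))) ^+ internal A * weight A)%:E.
Proof.
elim: A X t => [|a IHa b IHb] X t bX t0.
  rewrite /= expr0 !mulr1.
  exact: (probability_exponential_gt (bX.1 [::])).
(* [G] carries the lifetimes of all nodes but the root, so it is independent of [tau [::]]. *)
pose J : pred node := fun v => v != [::].
pose G := cylinders X J.
pose T' : measurableType _ := g_sigma_algebraType G.
pose E : set (R * T') := [set sw | [/\ 0 <= sw.1 <= t,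
  grown a (subtree (fun v => X v sw.2) false) (t - sw.1) &
  grown b (subtree (fun v => X v sw.2) true) (t - sw.1)]].
have mJ c v : measurable_fun setT (subtree X c v : T' -> R).
  by apply: measurable_cylinders; rewrite /J -size_eq0 size_rcons.
have mE : measurable E.
  pose h (sw : R * T') := (t - sw.1, sw.2).
  have mh : measurable_fun setT h.
    apply: measurable_fun_pair; last exact: measurable_snd.
    by apply: measurable_funB.
  have -> : E = [set sw : R * T' | 0 <= sw.1 <= t] `&`
    (h @^-1` [set rw | grown a (fun v => subtree X false v rw.2) rw.1] `&`
     h @^-1` [set rw | grown b (fun v => subtree X true v rw.2) rw.1]).
    by apply/seteqP; split => rw /= => [[? ? ?]|[? []]].
  apply: measurableI.
    by apply: measurable_set_between => //; exact: measurable_fst.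
  apply: measurableI; rewrite -[_ @^-1` _]setTI; apply: mh => //.
    exact: (measurable_grown (T := T') a (X := fun v w => subtree X false v w)
      (mJ false)).
  exact: (measurable_grown (T := T') b (X := fun v w => subtree X true v w)
      (mJ true)).
pose f s := weight a * weight b * expR (- (lambda * (t - s))) ^+ 2
  * (1 - expR (- (lambda * (t - s)))) ^+ (internal a + internal b).
have PE s : P (xsection E s) = ((f \_ `[0, t]) s)%:E.
  have -> : xsection E s = [set w | 0 <= s <= t] `&`
    ([set w | grown a (fun v => subtree X false v w) (t - s)] `&`
     [set w | grown b (fun v => subtree X true v w) (t - s)]).
    by apply/seteqP; split => w; rewrite /xsection /= inE /= => -[] // ? [].
  rewrite patchE; have [st|st] := boolP (0 <= s <= t); last first.
    rewrite ifF; last by apply/negbTE; rewrite notin_setE /= in_itv; apply/negP.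
    suff -> : [set w : T | false] = set0 by rewrite set0I measure0.
    by apply/seteqP; split.
  rewrite ifT; last by rewrite inE /= in_itv.
  suff -> : [set w : T | true] = setT; last by apply/seteqP; split.
  have ts0 : 0 <= t - s by rewrite subr_ge0; case/andP: st.
  rewrite setTI -[LHS]/(P (_ `&` _)).
  rewrite (cylinders_indep bX.2 (J1 := below false) (J2 := below true)).
  - rewrite IHa ?IHb //; try exact: pure_birth_subtree.
    by rewrite -EFinM /f exprD; congr EFin; ring.
  (* The default [~~ b] inside [below] keeps the root out of both sets; any other word has only one
     last letter. *)
  - by move=> v; rewrite /below; case: v => // x v; rewrite /= => /eqP ->.
  - exact: sigma_below.
  - exact: sigma_below.
rewrite -[LHS]/(P [set w | E (X [::] w, w)]).
rewrite probability_freeze //; first last.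
- move=> A B mA sB; apply: (cylinders_indep bX.2 (J1 := pred1 [::]) _ _ sB).
    by move=> v /= /eqP ->.
  by apply: sub_sigma_algebra; exact: cylinders_preimage.
- exact: cylinders_measurable.
have u1 s : s <= t -> expR (- (lambda * (t - s))) <= 1.
  by move=> st; rewrite -[leRHS]expR0 ler_expR oppr_le0 mulr_ge0 ?subr_ge0 // ltW.
have mf : measurable_fun setT f.
  have mu' : measurable_fun setT (fun s : R => expR (- (lambda * (t - s)))).
    apply: measurableT_comp => //; apply: measurableT_comp => //.
    by apply: measurable_funM => //; exact: measurable_funB.
  apply: measurable_funM.
    by apply: measurable_funM => //; exact: measurable_funX.
  by apply: measurable_funX; exact: measurable_funB.
under eq_integral do rewrite PE.
rewrite (integral_exponential_law l0 (bX.1 [::])); first last.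
- move=> s; rewrite lee_fin patchE; case: ifPn => //.
  rewrite inE /= in_itv /= => /andP[_ /u1 st].
  by rewrite /f !mulr_ge0 ?weight_ge0 ?exprn_ge0 ?expR_ge0 // subr_ge0.
- apply/measurable_EFinP.
  apply/(measurable_restrictT f (measurable_itv `[0, t])).
  exact: measurable_funTS.
rewrite [internal _]/= -(integral_yule lambda (weight a * weight b) _ t0).
rewrite [RHS]integral_mkcond; apply: eq_integral => s _ /=.
rewrite !patchE; case: ifPn => [|_]; last by rewrite mul0e.
by rewrite inE /= in_itv /= => /andP[s0 _]; rewrite exponential_pdfE // mulNr EFinM.
Qed.

End prob_grown.

(** * Leaves and the depth ratio *)

Section leaves_of_grown.
Context {R : realType}.
Implicit Types (tau : node -> R) (A : shape).

Fixpoint leaf_seq A : seq node :=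
  if A is Node a b then
    map (rcons^~ false) (leaf_seq a) ++ map (rcons^~ true) (leaf_seq b)
  else [:: [::]].

Lemma size_leaf_seq A : size (leaf_seq A) = (internal A).+1.
Proof.
by elim: A => //= a IHa b IHb; rewrite size_cat !size_map IHa IHb addSn addnS.
Qed.

Lemma sum_size_leaf_seq A : (\sum_(v <- leaf_seq A) size v)%N = path_length A.
Proof.
elim: A => [|a IHa b IHb] /=; first by rewrite big_seq1.
rewrite big_cat !big_map /=; under eq_bigr do rewrite size_rcons -addn1.
under [X in (_ + X)%N]eq_bigr do rewrite size_rcons -addn1.
rewrite !big_split /= IHa IHb !sum1_size !size_leaf_seq; lia.
Qed.

Lemma mem_leaf_seq_rcons a b c v :
  (rcons v c \in leaf_seq (Node a b)) = (v \in leaf_seq (if c then b else a)).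
Proof.
have inj e : injective (rcons^~ e : node -> node).
  by move=> u w /eqP; rewrite eqseq_rcons => /andP[/eqP].
have neq e s : e != c -> (rcons v c \in map (rcons^~ e) s) = false.
  move=> ec; apply/negbTE/mapP => -[u _ /eqP]; rewrite eqseq_rcons => /andP[_].
  by rewrite eq_sym (negPf ec).
rewrite /= mem_cat; case: c neq => neq.
  by rewrite neq //= (mem_map (inj true)).
by rewrite (mem_map (inj false)) neq // orbF.
Qed.

Lemma uniq_leaf_seq A : uniq (leaf_seq A).
Proof.
have inj e : injective (rcons^~ e : node -> node).
  by move=> u w /eqP; rewrite eqseq_rcons => /andP[/eqP].
elim: A => //= a IHa b IHb; rewrite cat_uniq !map_inj_uniq // IHa IHb andbT /=.
apply/hasPn => _ /mapP[v _ ->]; apply/mapP => -[u _ /eqP].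
by rewrite eqseq_rcons andbF.
Qed.

Lemma creation_time_ge0 tau v : (forall u, 0 <= tau u) -> 0 <= creation_time tau v.
Proof. by move=> tau0; elim: v => //= _ u IHu; exact: addr_ge0. Qed.

(** [creation_time] recurses on the most recent letter, whereas [grown] recurses from the root; this
    is the bridge between the two. *)
Lemma creation_time_rcons tau v b :
  creation_time tau (rcons v b) = tau [::] + creation_time (subtree tau b) v.
Proof.
elim: v => [|c v IHv] /=; first by rewrite add0r addr0.
by rewrite IHv addrA.
Qed.

Lemma leaves_rcons tau r v b :
  leaves tau r (rcons v b) = leaves (subtree tau b) (r - tau [::]) v.
Proof.
rewrite /leaves /= creation_time_rcons lerBrDl ltrBlDl addrA //.
Qed.

(** Induction on the shape, splitting off the letter chosen at the root. Nonnegativity of every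
    lifetime, including those of unborn nodes, ensures that no descendant of an unsplit root is
    created by time [r]. *)
Lemma leaves_grown A tau r : 0 <= r -> (forall u, 0 <= tau u) ->
  grown A tau r -> leaves tau r = [set` leaf_seq A].
Proof.
move=> r0 tau0 gA; apply/seteqP.
suff H v : leaves tau r v <-> v \in leaf_seq A by split=> v /=; have [] := H v.
elim: A tau r r0 tau0 gA v => [|a IHa b IHb] tau r r0 tau0 gA v.
  case/lastP: v => [|v c].
    by rewrite /leaves /= r0 add0r gA inE eqxx.
  rewrite leaves_rcons /leaves /= inE -size_eq0 size_rcons; split => //.
  move=> /andP[+ _]; have := creation_time_ge0 v (fun u => tau0 (rcons u c)).
  move=> /le_trans /[apply]; rewrite subr_ge0 => /(lt_le_trans gA).
  by rewrite ltxx.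
case: gA => /andP[_ tr] ga gb; case/lastP: v => [|v c].
  split; first by rewrite /leaves /= add0r r0 ltNge tr.
  by rewrite /= mem_cat => /orP[] /mapP[u _ /(congr1 size)]; rewrite size_rcons.
rewrite leaves_rcons mem_leaf_seq_rcons; case: c.
  by apply: IHb gb _ => [|u]; [rewrite subr_ge0|exact: tau0].
by apply: IHa ga _ => [|u]; [rewrite subr_ge0|exact: tau0].
Qed.

Lemma perm_fset_set_seq (I : choiceType) (s : seq I) : uniq s ->
  perm_eq (fset_set [set` s]) s.
Proof.
move=> us; apply: uniq_perm => // v; rewrite in_fset_set.
  by rewrite mem_setE.
exact: finite_seq.
Qed.

Lemma grown_counts A tau r : 0 <= r -> (forall u, 0 <= tau u) ->
  grown A tau r ->
  leaf_count tau r = (internal A).+1 /\ leaf_depth_sum tau r = path_length A.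
Proof.
move=> r0 tau0 gA; rewrite /leaf_count /leaf_depth_sum (leaves_grown r0 tau0 gA).
have p := perm_fset_set_seq (uniq_leaf_seq A).
by rewrite (perm_size p) size_leaf_seq (perm_big _ p) sum_size_leaf_seq.
Qed.

End leaves_of_grown.

(** * Measurability of the ratio of depth sum to leaf count *)

Section measurability.
Context d (T : measurableType d) (R : realType).

Lemma bigcup_measurable_count (I : countType) (D : set I) (F : I -> set T) :
  (forall i, D i -> measurable (F i)) -> measurable (\bigcup_(i in D) F i).
Proof.
move=> mF.
pose G n := if @choice.unpickle I n is Some i
  then if `[< D i >] then F i else set0 else set0.
have -> : \bigcup_(i in D) F i = \bigcup_n G n.
  apply/seteqP; split=> [x [i Di Fx]|x [n _]].
    by exists (choice.pickle i) => //; rewrite /G choice.pickleK; case: asboolP.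
  by rewrite /G; case: choice.unpickle => // i; case: asboolP => // Di Fx; exists i.
apply: bigcupT_measurable => n; rewrite /G; case: choice.unpickle => // i.
by case: asboolP => // /mF.
Qed.

Lemma bigcap_measurable_count (I : countType) (F : I -> set T) :
  (forall i, measurable (F i)) -> measurable (\bigcap_i F i).
Proof.
move=> mF; rewrite -[X in measurable X]setCK setC_bigcap; apply: measurableC.
by apply: bigcup_measurable_count => i _; exact: measurableC.
Qed.

(** One value [i0] may be left unchecked: its preimage is the complement of all the others. *)
Lemma measurable_fun_count (I : countType) (i0 : I) (Y : T -> I) (psi : I -> R) :
  (forall i, i != i0 -> measurable (Y @^-1` [set i])) ->
  measurable_fun setT (psi \o Y).
Proof.
move=> mY.
have mY0 i : measurable (Y @^-1` [set i]).
  have [->|/mY //] := eqVneq i i0.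
  have -> : Y @^-1` [set i0] = ~` (\bigcup_(i in [set i | i != i0]) Y @^-1` [set i]).
    apply/seteqP; split=> [w /= Yw [j /= j0 Yj]|w /= nY].
      by move: j0; rewrite -Yj Yw eqxx.
    by apply: contrapT => /eqP Yi0; apply: nY; exists (Y w).
  by apply/measurableC/bigcup_measurable_count => j; exact: mY.
move=> _ B _; rewrite setTI.
have -> : (psi \o Y) @^-1` B = \bigcup_(i in [set i | B (psi i)]) Y @^-1` [set i].
  by apply/seteqP; split=> [w Bw|w [i /= Bi ->]] //; exists (Y w).
by apply: bigcup_measurable_count.
Qed.

Variable X : node -> T -> R.
Hypothesis mX : forall v, measurable_fun setT (X v).

Lemma measurable_creation_time v :
  measurable_fun setT (fun w => creation_time (X^~ w) v).
Proof.
elim: v => [|c v IHv] /=; first exact: measurable_cst.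
exact: measurable_funD.
Qed.

Lemma measurable_leaf t v : measurable [set w | leaves (X^~ w) t v].
Proof.
have -> : [set w | leaves (X^~ w) t v] = [set w | creation_time (X^~ w) v <= t] `&`
    [set w | t < creation_time (X^~ w) v + X v w].
  by apply/seteqP; split => w /= => [/andP[]|[? ?]]; [|apply/andP].
apply: measurableI.
  by apply: measurable_set_ler => //; exact: measurable_creation_time.
apply: measurable_set_ltr => //; apply: measurable_funD => //.
exact: measurable_creation_time.
Qed.

(** The exempt value is [fset0], which [fset_set] also returns on infinite sets. A nonempty value
    [S] determines the set of leaves, so its preimage is a countable intersection of leaf events and
    their complements. *)
Lemma measurable_depth_ratio t : measurable_fun setT
  (fun w => (leaf_depth_sum (X^~ w) t)%:R / (leaf_count (X^~ w) t)%:R : R).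
Proof.
pose Y w : {fset node} := fset_set (leaves (X^~ w) t).
pose psi (S : {fset node}) : R := (\sum_(v <- S) size v)%N%:R / #|` S|%:R.
apply: (@measurable_fun_count _ fset0 Y psi) => S S0.
have -> : Y @^-1` [set S] = \bigcap_v
    (if v \in S then [set w | leaves (X^~ w) t v] else ~` [set w | leaves (X^~ w) t v]).
  apply/seteqP; split=> [w /= YS v _|w /= H].
    have fin : finite_set (leaves (X^~ w) t).
      apply: contrapT => nfin; move: YS; rewrite /Y /fset_set.
      by case: pselect => // _ /eqP; rewrite eq_sym (negPf S0).
    move: YS => <-; rewrite in_fset_set //.
    by case: ifPn; rewrite ?inE ?notin_setE.
  rewrite /Y -[RHS]set_fsetK; congr fset_set; apply/seteqP; split => v /=.
    by have := H v I; case: ifP.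
  by move=> vS; have := H v I; rewrite vS.
apply: bigcap_measurable_count => v; case: ifP => _; last apply: measurableC;
  exact: measurable_leaf.
Qed.

End measurability.

(** * Mean and variance of the ratio at a fixed time *)

Section law.
Context d (T : measurableType d) (R : realType) (P : probability T R).
Context (lambda : R) (tau : node -> {RV P >-> R}).
Hypotheses (l0 : 0 < lambda) (btau : pure_birth_lifetimes lambda tau).
Variable t : R.
Hypothesis t0 : 0 <= t.

Let q : R := 1 - expR (- (lambda * t)).

Let q0 : 0 <= q.
Proof. by rewrite subr_ge0 -[leRHS]expR0 ler_expR oppr_le0 mulr_ge0 // ltW. Qed.

Let q1 : q < 1.
Proof. by rewrite ltrBlDr ltrDl expR_gt0. Qed.

Let pE : expR (- (lambda * t)) = 1 - q.
Proof. by rewrite /q; ring. Qed.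

Definition positive_lifetimes : set T := [set w | forall v, 0 < tau v w].

Let mtau v : measurable_fun setT (tau v : T -> R).
Proof. exact: measurable_funP. Qed.

Lemma measurable_positive_lifetimes : measurable positive_lifetimes.
Proof.
have -> : positive_lifetimes = \bigcap_v [set w | 0 < tau v w].
  by apply/seteqP; split => w /= H v; [move=> _; exact: H | exact: (H v I)].
by apply: bigcap_measurable_count => v; exact: measurable_set_ltr.
Qed.

(** Each lifetime is positive with probability [expR 0 = 1], and there are countably many nodes. *)
Lemma prob_positive_lifetimes : P (~` positive_lifetimes) = 0%E.
Proof.
have -> : ~` positive_lifetimes = \bigcup_v ~` [set w | 0 < tau v w].
  rewrite -setC_bigcap; congr (~` _); apply/seteqP; split => w /= H v.
    by move=> _; exact: H.
  exact: (H v I).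
have mv v : measurable [set w | 0 < tau v w] by exact: measurable_set_ltr.
have Pv v : P (~` [set w | 0 < tau v w]) = 0%E.
  rewrite probability_setC // (probability_exponential_gt (btau.1 v)) //.
  by rewrite mulr0 oppr0 expR0 subee.
pose N n := if @choice.unpickle (node : countType) n is Some v
  then ~` [set w | 0 < tau v w] else set0.
have -> : \bigcup_v ~` [set w | 0 < tau v w] = \bigcup_n N n.
  apply/seteqP; split=> [w [v _ Hv]|w [n _]].
    by exists (choice.pickle v) => //; rewrite /N choice.pickleK.
  by rewrite /N; case: choice.unpickle => // v Hv; exists v.
have mN n : measurable (N n).
  by rewrite /N; case: choice.unpickle => // v; exact: measurableC.
apply: measure_negligible; first exact: bigcupT_measurable.
apply: negligible_bigcup => n; apply/negligibleP => //.
by rewrite /N; case: choice.unpickle => [v|]; [exact: Pv|exact: measure0].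
Qed.

(* A negative lifetime inside an unborn subtree would add spurious leaves to
   [leaves], hence the second condition. *)
Definition shape_event A : set T :=
  [set w | grown A (fun v => tau v w) t] `&` positive_lifetimes.

Lemma measurable_shape_event A : measurable (shape_event A).
Proof.
apply: measurableI; last exact: measurable_positive_lifetimes.
by apply: measurable_grown_at.
Qed.

Lemma prob_shape_event A :
  P (shape_event A) = ((1 - q) * q ^+ internal A * weight A)%:E.
Proof.
transitivity (P [set w | grown A (fun v => tau v w) t]); last first.
  by rewrite (prob_grown l0 A btau t0) -pE.
rewrite /shape_event.
have mg : measurable [set w | grown A (fun v => tau v w) t].
  exact: measurable_grown_at.
have mp := measurable_positive_lifetimes.
rewrite [RHS](measureDI P mg mp) [X in _ = (X + _)%E](_ : _ = 0%E) ?add0e //.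
apply: measure_negligible; first exact: measurableD.
apply: (@negligibleS _ _ _ _ (~` positive_lifetimes)); first exact: subDsetr.
by apply/negligibleP; [exact: measurableC|exact: prob_positive_lifetimes].
Qed.

Lemma shape_event_inj A B w : shape_event A w -> shape_event B w -> A = B.
Proof. by move=> [gA _] [gB _]; exact: grown_inj gA gB. Qed.

Let depth_ratio w : R := (leaf_depth_sum (fun v => tau v w) t)%:R /
  (leaf_count (fun v => tau v w) t)%:R.

Lemma depth_ratio_shape_event A w : shape_event A w ->
  depth_ratio w = (path_length A)%:R / (internal A).+1%:R.
Proof.
move=> [gA pw]; rewrite /depth_ratio.
by have [-> ->] := grown_counts t0 (fun u => ltW (pw u)) gA.
Qed.

(** [n] counts internal nodes, so on this event the tree has [n + 1] leaves. *)
Definition size_event n : set T := \big[setU/set0]_(A <- shapes n) shape_event A.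

Lemma size_eventP n w :
  size_event n w <-> exists2 A, internal A = n & shape_event A w.
Proof.
rewrite /size_event -bigcup_seq; split=> [[A /= An ?]|[A An ?]]; exists A => //.
  by apply/eqP; rewrite -mem_shapes.
by rewrite /= mem_shapes An.
Qed.

Lemma measurable_size_event n : measurable (size_event n).
Proof. by apply: bigsetU_measurable => A _; exact: measurable_shape_event. Qed.

Lemma trivIset_size_event : trivIset setT size_event.
Proof.
apply/trivIsetP => i j _ _ ij; apply/seteqP; split=> // w [].
move=> /size_eventP[A Ai wA] /size_eventP[B Bj wB].
by move: ij; rewrite -Ai -Bj (shape_event_inj wA wB) eqxx.
Qed.

Lemma trivIset_shape_event (D : set shape) : trivIset D shape_event.
Proof.
apply/trivIsetP => A B _ _ AB; apply/seteqP; split=> // w [wA wB].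
by move: AB; rewrite (shape_event_inj wA wB) eqxx.
Qed.

(** A size event is a finite disjoint union of shape events, and the ratio is constant on each of
    them. *)
Lemma integral_size_event (phi : R -> R) n : measurable_fun setT phi ->
  (forall x, 0 <= phi x) ->
  (\int[P]_(w in size_event n) (phi (depth_ratio w))%:E =
   ((1 - q) * q ^+ n *
     shape_mean (fun A => phi ((path_length A)%:R / n.+1%:R)) n)%:E)%E.
Proof.
move=> mphi phi0.
have mg : measurable_fun setT (fun w => (phi (depth_ratio w))%:E).
  apply/measurable_EFinP; apply: measurableT_comp => //.
  exact: measurable_depth_ratio.
rewrite ge0_integral_bigsetU //=; first last.
- by move=> w _; rewrite lee_fin.
- exact: measurable_funTS.
- exact: trivIset_shape_event.
- exact: shapes_uniq.
- exact: measurable_shape_event.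
rewrite /shape_mean mulr_sumr -sumEFin big_seq [RHS]big_seq; apply: eq_bigr => A.
rewrite mem_shapes => /eqP An.
rewrite (eq_integral (cst (phi ((path_length A)%:R / n.+1%:R))%:E)); last first.
  by move=> w; rewrite inE => /depth_ratio_shape_event ->; rewrite An.
rewrite integral_cst //; last exact: measurable_shape_event.
rewrite [X in (_ * X)%E](_ : _ = P (shape_event A)) // prob_shape_event An.
by rewrite -EFinM; congr EFin; ring.
Qed.

Lemma cvg_EFin_series (u : R^nat) (l : R) : series u @ \oo --> l ->
  (\sum_(n <oo) (u n)%:E = l%:E)%E.
Proof.
move=> ul; apply/cvg_lim => //.
have -> : (fun n => \sum_(0 <= i < n) (u i)%:E)%E = EFin \o series u.
  by apply/funext => n /=; rewrite sumEFin.
by apply/cvg_EFin => //; exact: nearW.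
Qed.

(** The size events have the probabilities of a geometric law, which sum to 1; so the tree is almost
    surely finite. *)
Lemma prob_size_event_cover : P (~` \bigcup_n size_event n) = 0%E.
Proof.
have mU : measurable (\bigcup_n size_event n).
  by apply: bigcupT_measurable; exact: measurable_size_event.
rewrite probability_setC //.
suff -> : P (\bigcup_n size_event n) = 1%E by rewrite subee.
rewrite measure_bigcup //; last exact: trivIset_size_event.
  rewrite (eq_eseriesr (g := fun n => ((1 - q) * q ^+ n * 1)%:E)).
    rewrite (eq_eseriesl (Q := xpredT)); last by move=> n; rewrite in_setT.
    apply: cvg_EFin_series; exact: (geometric_mean_cst q0 q1 1).
  move=> n _.
  transitivity (\int[P]_(w in size_event n) (cst 1%R (depth_ratio w))%:E)%E.
    rewrite (integral_cst _ _ 1%E) ?mul1e //; exact: measurable_size_event.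
  by rewrite integral_size_event // shape_mean1.
by move=> n _; exact: measurable_size_event.
Qed.

Lemma integral_depth_ratio (phi : R -> R) (l : R) : measurable_fun setT phi ->
  (forall x, 0 <= phi x) ->
  geometric_mean q
    (fun n => shape_mean (fun A => phi ((path_length A)%:R / n.+1%:R)) n) l ->
  (\int[P]_w (phi (depth_ratio w))%:E = l%:E)%E.
Proof.
move=> mphi phi0 gm.
have mg : measurable_fun setT (fun w => (phi (depth_ratio w))%:E).
  apply/measurable_EFinP; apply: measurableT_comp => //.
  exact: measurable_depth_ratio.
have mU : measurable (\bigcup_n size_event n).
  by apply: bigcupT_measurable; exact: measurable_size_event.
rewrite (ge0_negligible_integral (measurableC mU)) //; last first.
- exact: prob_size_event_cover.
- by move=> w _; rewrite lee_fin.
rewrite setTD setCK ge0_integral_bigcup //; first last.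
- exact: trivIset_size_event.
- by move=> w _; rewrite lee_fin.
- exact: measurable_funTS.
- exact: measurable_size_event.
rewrite -(cvg_EFin_series gm); apply: eq_eseriesr => n _.
exact: integral_size_event.
Qed.

Lemma expectation_depth_ratio : ('E_P[depth_ratio] = (2 * (log_series q - 1))%:E)%E.
Proof.
(* [integral_depth_ratio] wants a nonnegative function; the absolute value serves, since the ratio
   is nonnegative. *)
rewrite unlock -(@integral_depth_ratio Num.norm) //.
- apply: eq_integral => w _; rewrite ger0_norm // divr_ge0 //.
apply: (eq_geometric_mean _ (geometric_mean_mean_path q0 q1)) => n.
rewrite -shape_mean_path_length mulrC -shape_meanZ; apply: eq_shape_mean => A _.
by rewrite ger0_norm ?divr_ge0 // mulrC.
Qed.

Lemma variance_depth_ratio : ('V_P[depth_ratio] = (limit_variance q)%:E)%E.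
Proof.
rewrite /variance unlock expectation_depth_ratio unlock /=.
set c := 2 * (log_series q - 1).
(* Integrating the centered square directly keeps the integrand nonnegative. *)
rewrite -(@integral_depth_ratio (fun x => (x - c) ^+ 2)) //.
- by apply: measurable_funX; exact: measurable_funB.
- by move=> x; exact: sqr_ge0.
apply: (eq_geometric_mean _ (geometric_mean_variance q0 q1)) => n.
rewrite -/c -shape_mean_sq_path_length -shape_mean_path_length.
transitivity (shape_mean (fun A => n.+1%:R ^- 2 * (path_length A)%:R ^+ 2
  + (- (2 * c) / n.+1%:R) * (path_length A)%:R + c ^+ 2) n).
  rewrite !shape_meanD !shape_meanZ shape_mean_cst.
  by congr (_ + _ + _); [rewrite mulrC | ring].
apply: eq_shape_mean => A _; field; rewrite nat1r pnatr_eq0 //.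
Qed.

End law.

Theorem theorem1 (d : measure_display) (T : measurableType d) (R : realType)
    (P : probability T R) (lambda : R) (tau : node -> {RV P >-> R}) :
  0 < lambda ->
  pure_birth_lifetimes lambda tau ->
  let Z (t : R) (w : T) := leaf_count (fun v => tau v w) t in
  let G (t : R) (w : T) := leaf_depth_sum (fun v => tau v w) t in
  'V_P[fun w => (G t w)%:R / (Z t w)%:R] @[t --> +oo] --> 7%:E.
Proof.
move=> l0 btau Z G.
have V t : 0 <= t -> ('V_P[fun w => (G t w)%:R / (Z t w)%:R]%R =
    (limit_variance (1 - expR (- (lambda * t))))%:E)%E.
  exact: variance_depth_ratio.
have near0 : \forall t \near (+oo : set_system R), 0 <= t.
  by apply: nbhs_pinfty_ge; rewrite num_real.
(* The variance is extended-real valued; it is finite for [t >= 0], so the limit may be taken in the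
   reals. *)
apply: cvg_EFin.
  by apply: filterS near0 => t /V ->.
apply: cvg_trans (cvg_limit_variance l0); apply: near_eq_cvg.
by apply: filterS near0 => t /V /= ->.
Qed.
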